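(* Let $p$ be an odd prime, $m\ge1$, $q$ a prime power with $p\nmid q$, and $K=\overline{\mathbb{F}}_q$. (i) If $\mathrm{PGL}_n(q)$ contains an elementary abelian subgroup $\Lambda$ of order $p^{2m}$, not contained in any maximal torus of $\mathrm{PGL}_n(K)$, such that $C_{\mathrm{PGL}_n(q)}(\Lambda)\cong\Lambda\times\mathrm{PGL}_k(q)$ for some $1\le k<n$ and $N_{\mathrm{PGL}_n(q)}(\Lambda)/C_{\mathrm{PGL}_n(q)}(\Lambda)\cong\mathrm{Sp}_{2m}(p)$, then $p^m\mid n$ and $q\equiv1\pmod p$. (ii) Conversely, if $p^m\mid n$ and $q\equiv1\pmod p$, then there exists such a subgroup $\Lambda$ (of order $p^{2m}$, nontoral in $\mathrm{PGL}_n(K)$, with $C_{\mathrm{PGL}_n(q)}(\Lambda)\cong\Lambda\times\mathrm{PGL}_k(q)$ for some $1\le k<n$ and $N_{\mathrm{PGL}_n(q)}(\Lambda)/C_{\mathrm{PGL}_n(q)}(\Lambda)\cong\mathrm{Sp}_{2m}(p)$).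
   Context: $\mathrm{PGL}_n(q)$ is viewed as the group of fixed points of the standard Frobenius endomorphism on $\mathrm{PGL}_n(K)$. *)

(* Defs.v *)
From HB Require Import structures.
From mathcomp Require Import all_boot all_order all_algebra all_fingroup all_solvable all_field.
Set Implicit Arguments. Unset Strict Implicit. Unset Printing Implicit Defensive.
Import GRing.Theory.
Local Open Scope ring_scope.

(* Projective general linear group PGL_n(F) = GL_n(F) / Z(GL_n(F)) (the center
   of GL_n(F) is the group of nonzero scalar matrices).  MathComp's {'GL_n[F]}
   consists of n.-1.+1 square matrices, so n >= 1 is assumed where used. *)
Definition PGLtype (n : nat) (F : finFieldType) := coset_of 'Z('GL_n[F]).

Definition PGL (n : nat) (F : finFieldType) : {group PGLtype n F} :=
  ('GL_n[F] / 'Z('GL_n[F]))%G.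

(* K is algebraic over F via f (together with K algebraically closed, K is an
   algebraic closure of F). *)
Definition algebraic_over (F K : fieldType) (f : {rmorphism F -> K}) :=
  forall x : K, exists2 P : {poly F}, P != 0 & root (map_poly f P) x.

(* L <= PGL_n(F) <= PGL_n(K) is contained in a maximal torus of PGL_n(K):
   the maximal tori of PGL_n(K) are the images of the conjugates P D P^-1
   of the diagonal torus D of GL_n(K); so L is toral iff there is P in
   GL_n(K) such that every lift g in GL_n(F) of an element of L satisfies
   P^-1 g P diagonal. *)
Definition toral_in (n : nat) (F : finFieldType) (K : fieldType)
    (f : {rmorphism F -> K}) (L : {set PGLtype n F}) : Prop :=
  exists2 P : 'M[K]_n.-1.+1, P \in unitmx &
    forall g : {'GL_n[F]}, coset 'Z('GL_n[F]) g \in L ->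
      is_diag_mx (invmx P *m map_mx f (GLval g) *m P).

(* The standard symplectic Gram matrix [[0, I_m], [-I_m, 0]] of size N
   (used with N = 2m). *)
Definition sympJ (R : nzRingType) (m N : nat) : 'M[R]_N :=
  \matrix_(i < N, j < N)
    (if ((nat_of_ord i < m)%N && (nat_of_ord j == (nat_of_ord i + m)%N))
     then 1
     else if ((m <= nat_of_ord i)%N && (nat_of_ord i == (nat_of_ord j + m)%N))
     then -1 else 0).

Definition Sp (m p : nat) : {set {'GL_(2 * m)['F_p]}} :=
  [set g : {'GL_(2 * m)['F_p]} |
     (GLval g)^T *m sympJ _ m _ *m GLval g == sympJ _ m _].

(* Main.v *)
Require Import Defs.
From HB Require Import structures.
From mathcomp Require Import all_boot all_order all_algebra all_fingroup all_solvable all_field.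
From mathcomp Require Import zify ring.
Set Implicit Arguments. Unset Strict Implicit. Unset Printing Implicit Defensive.
Import Order.TTheory GRing.Theory Num.Theory.

(* Lift an elementary abelian p-subgroup L of PGL_n(F) to a set of matrices W_x, x in L; they commute up to scalars, W_x W_y = X(x,y) W_y W_x, and X is an alternating pairing of L with values in the p-th roots of unity of F.

   (i) If X is trivial, the lifts are diagonalizable and commute, so L is toral; hence X is nontrivial and p divides #|F| - 1. The radical R of X is stable under N(L). If m = 1, then |R| = p would make the preimage of L cyclic modulo a central subgroup, hence abelian. If m > 1, take a primitive prime divisor l of p^(2m) - 1 (Zsigmondy): it divides |Sp_2m(p)|, and counting fixed points shows that an l-element of N(L) with a proper nontrivial invariant subgroup of L centralises L. So R = 1. For nondegenerate X, averaging over L gives M_n(F) = (+)_x W_x D with D the commutant of the W_x, so n^2 = p^(2m) dim D and p^m divides n.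

   (ii) Take the Heisenberg-Weyl matrices W_v, v in F_p^(2m), of size p^m, tensored with the identity of size k = n / p^m, normalised so that W_u W_v = w^(B(u,v)) W_(u+v) with B the symplectic form. The decomposition above, whose D is now M_k(F), gives the centraliser. A symplectic S preserves the cocycle, so v |-> W_(Sv) is again such a system; averaging and Schur's lemma give P with P W_v = W_(Sv) P. Hence N/C is the full symplectic group. *)

(** * Primitive prime divisors *)

Section CyclotomicValue.
Local Open Scope nat_scope.
Variables a N : nat.
Hypotheses (a_gt2 : 2 < a) (N_gt2 : 2 < N).

Let c : nat := `|('Phi_N).[a%:Z]%R|%N.

Let N_gt0 : 0 < N. Proof. exact: ltnW (ltnW N_gt2). Qed.
Let a_gt0 : 0 < a. Proof. exact: ltnW (ltnW a_gt2). Qed.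

Let horner_prodPhi d : 0 < d ->
  \prod_(i <- divisors d) `|('Phi_i).[a%:Z]%R|%N = (a ^ d).-1.
Proof.
move=> d_gt0.
transitivity `|(\prod_(i <- divisors d) 'Phi_i).[a%:Z]%R|%N.
  by rewrite horner_prod (big_morph absz abszM (erefl _ : `|1%R| = 1)).
rewrite prod_Cyclotomic // !hornerE -[1%R]/(1%:Z)%R.
have -> : (a%:Z ^+ d = (a ^ d)%N%:Z)%R by rewrite -!natz natrX.
by rewrite subzn ?expn_gt0 ?a_gt0 // subn1.
Qed.

(** a^N - 1 is the product of the values at a of the cyclotomic polynomials of index dividing N.
    Those of index dividing d multiply to a^d - 1, and index N is not among them. *)
Let c_dvd d : d %| N -> d < N -> c * (a ^ d).-1 %| (a ^ N).-1.
Proof.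
move=> dN ltdN; have d_gt0 := dvdn_gt0 N_gt0 dN.
rewrite -!horner_prodPhi // [X in _ %| X](big_rem N) -?dvdn_divisors //=.
apply: dvdn_mul => //.
suff pD : perm_eq (divisors d) [seq i <- rem N (divisors N) | i \in divisors d].
  by rewrite (perm_big _ pD) big_filter [X in _ %| X](bigID [in divisors d]) dvdn_mulr.
apply: uniq_perm; rewrite ?filter_uniq ?rem_uniq ?divisors_uniq // => i.
rewrite mem_filter mem_rem_uniq ?divisors_uniq // !inE -!dvdn_divisors //.
apply/esym/andb_idr => id; rewrite (dvdn_trans id dN) andbT.
by rewrite ltn_eqF // (leq_ltn_trans _ ltdN) // dvdn_leq.
Qed.

(** Over [algC] the value is a product of [totient N] factors a - zeta with |zeta| = 1, each of
    modulus at least a - 1 >= 2. *)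
Let c_ge : 2 ^ totient N <= c.
Proof.
have [z z_prim] := C_prim_root_exists N_gt0.
have n1z : (`|z| = 1)%R.
  by apply/eqP; rewrite -(pexpr_eq1 N_gt0) // -normrX (prim_expr_order z_prim) normr1.
rewrite -(@ler_nat algC) /c natr_absz intr_norm.
have -> : (('Phi_N).[a%:Z]%:~R = (cyclotomic z N).[a%:R] :> algC)%R.
  by rewrite -(Cintr_Cyclotomic z_prim) (horner_map _ _ a%:Z).
have -> : totient N = #|[pred k : 'I_N | coprime k N]|.
  rewrite totient_count_coprime big_mkord -sum1_card [RHS]big_mkcond.
  by apply: eq_bigr => k _ /=; rewrite coprime_sym inE; case: coprime.
rewrite horner_prod normr_prod natrX -prodr_const.
apply: ler_prod => k _; rewrite ler0n !hornerE /=.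
apply: le_trans (lerB_dist _ _).
rewrite normrX n1z expr1n normr_nat lerBrDr -(natrD _ 2 1).
by rewrite ler_nat.
Qed.

Lemma cyclotomic_value : exists2 c, 2 ^ totient N <= c &
  forall d, d %| N -> d < N -> c * (a ^ d).-1 %| (a ^ N).-1.
Proof. by exists c. Qed.
End CyclotomicValue.

Section Zsigmondy.
Local Open Scope nat_scope.
Variables a N c : nat.
(* c stands for the absolute value of the N-th cyclotomic polynomial at a, kept abstract so that unification never unfolds it. *)
Hypotheses (a_gt2 : 2 < a) (N_gt2 : 2 < N) (c_ge : 2 ^ totient N <= c).
Hypothesis c_dvd : forall d, d %| N -> d < N -> c * (a ^ d).-1 %| (a ^ N).-1.

Let N_gt0 : 0 < N. Proof. exact: ltnW (ltnW N_gt2). Qed.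
Let a_gt0 : 0 < a. Proof. exact: ltnW (ltnW a_gt2). Qed.

(** Take d = N / r in [c_dvd] and cancel a^(N/r) - 1: the sum is the cofactor of that number in a^N
    - 1. *)
Let sum_dvd r : prime r -> r %| N -> c %| \sum_(i < r) (a ^ (N %/ r)) ^ i.
Proof.
move=> r_pr rN; have r_gt1 := prime_gt1 r_pr.
have:= c_dvd (dvdn_div rN) (ltn_Pdiv r_gt1 N_gt0).
rewrite -{2}(divnK rN) expnM (predn_exp (a ^ _) r) mulnC dvdn_pmul2l // -subn1 subn_gt0.
apply: leq_trans (ltnW a_gt2) _.
have Nr_gt0 : 0 < N %/ r by rewrite divn_gt0 ?prime_gt0 // dvdn_leq.
by rewrite -{1}(expn1 a) (leq_pexp2l a_gt0 Nr_gt0).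
Qed.

(* For a prime r dividing N / e, the number c divides 1 + y + ... + y^(r-1) with y = a^(N/r) = 1 mod l, so l divides r. *)
Let nonprimitive_factor l d : prime l -> l %| c -> 0 < d < N ->
  l %| (a ^ d).-1 ->
  exists e k, [/\ N = e * l ^ k.+1, e < l & a ^ (N %/ l) = 1 %[mod l]].
Proof.
move=> l_pr lc /andP[d_gt0 ltdN] ld.
have l_gt1 := prime_gt1 l_pr.
have cN : c %| (a ^ N).-1.
  exact: dvdn_trans (dvdn_mulr _ (dvdnn c)) (c_dvd (dvd1n N) (ltnW N_gt2)).
have mod1 i : (l %| (a ^ i).-1) = (a ^ i == 1 %[mod l]).
  by rewrite -subn1 eqn_mod_dvd // expn_gt0 a_gt0.
have exE : exists i, (0 < i) && (l %| (a ^ i).-1) by exists d; rewrite d_gt0.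
(* [e] is the multiplicative order of a modulo l, so [dvde] below turns a^i = 1 mod l into e | i. *)
case: (ex_minnP exE) => e /andP[e_gt0 le] e_min.
have dvde i : (l %| (a ^ i).-1) = (e %| i).
  have /eqP le1 : a ^ e == 1 %[mod l] by rewrite -mod1.
  have -> : (l %| (a ^ i).-1) = (l %| (a ^ (i %% e)).-1).
    rewrite !mod1 {1}(divn_eq i e) expnD.
    by rewrite [i %/ e * e]mulnC expnM -modnMml -modnXm le1 modnXm exp1n modnMml mul1n.
  have [ie0 | i_gt0] := posnP (i %% e); first by rewrite ie0 expn0 dvdn0 /dvdn ie0.
  rewrite [RHS]/dvdn (gtn_eqF i_gt0); apply/negP => li.
  by have := e_min (i %% e); rewrite i_gt0 li leqNgt ltn_mod e_gt0 => /(_ isT).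
have eN : e %| N by rewrite -dvde (dvdn_trans lc) // cN.
have a_l : coprime a l.
  rewrite coprime_sym prime_coprime //; apply: contraL le => la.
  rewrite -subn1 dvdn_subr ?expn_gt0 ?a_gt0 ?dvdn_exp //.
  by rewrite dvdn1 gtn_eqF.
have ltel : e < l.
  rewrite -(prednK (ltnW l_gt1)) ltnS; apply: e_min.
  rewrite -subn1 subn_gt0 l_gt1 subn1 mod1 -(totient_prime l_pr).
  by apply/eqP; apply: Euler_exp_totient.
have rE r : prime r -> r %| N %/ e -> r = l /\ a ^ (N %/ l) = 1 %[mod l].
  move=> r_pr rNe; have rN : r %| N by rewrite (dvdn_trans rNe) ?dvdn_div.
  have y1 : a ^ (N %/ r) = 1 %[mod l].
    by apply/eqP; rewrite -mod1 dvde dvdn_divRL // mulnC -dvdn_divRL.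
  suff rl : r = l by rewrite -rl in y1 *.
  apply/esym/eqP; rewrite -dvdn_prime2 //.
  have := dvdn_trans lc (sum_dvd r_pr rN); rewrite /dvdn -modn_summ.
  rewrite (eq_bigr (fun=> 1 %% l)) => [|i _]; last first.
    by rewrite -modnXm y1 modnXm exp1n.
  by rewrite modn_summ sum1_card card_ord.
have Ne_gt1 : 1 < N %/ e.
  by rewrite ltn_divRL // mul1n (leq_ltn_trans _ ltdN) // e_min // d_gt0.
have Ne_gt0 := ltnW Ne_gt1.
have NeE : N %/ e = l ^ logn l (N %/ e).
  rewrite -(p_part l (N %/ e)); apply/esym/part_pnat_id/pnatP => // r r_pr rNe.
  by case: (rE r r_pr rNe) => ->; rewrite inE.
have [rl y1] := rE _ (pdiv_prime Ne_gt1) (pdiv_dvd _).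
have: 0 < logn l (N %/ e).
  by rewrite logn_gt0 mem_primes l_pr Ne_gt0 -rl pdiv_dvd.
move: NeE; case: (logn _ _) => // k NeE _.
by exists e, k; split=> //; rewrite -NeE mulnC divnK.
Qed.

(* 1 + y + ... + y^(l-1) is l modulo l^2 when y = 1 mod l, except that for l = 2 one needs y to be an odd square. *)
Let nonprimitive_square l e k : prime l -> N = e * l ^ k.+1 -> e < l ->
  a ^ (N %/ l) = 1 %[mod l] -> ~~ (l ^ 2 %| c).
Proof.
move=> l_pr NE ltel y1; have l_gt1 := prime_gt1 l_pr.
have lN : l %| N by rewrite NE expnS mulnCA dvdn_mulr.
apply/negP => l2c; have := dvdn_trans l2c (sum_dvd l_pr lN); apply/negP.
have [l2 | l_neq2] := eqVneq l 2.
  (* Here e = 1 and N is a power of 2 above 2, so y is the square of z = a^(N/4), and 1 + y is 2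
     modulo 4. *)
  move: ltel N_gt2 N_gt0 y1; rewrite NE l2; case: e {NE} => [|[|?]] // _.
  rewrite !mul1n expnS mulKn //; case: k => // k _ _.
  rewrite !big_ord_recl big_ord0 expn0 expn1 addn0 expnSr expnM.
  set z := a ^ _; rewrite !modn2 oddX /= => z_odd.
  have /dvdnP[w zE] : 2 %| z.-1.
    by move: z_odd; rewrite dvdn2; case: (z) => //= z'; case: odd.
  have {}zE : z = w * 2 + 1 by rewrite -zE addn1 prednK //; case: (z) z_odd.
  apply/negP => /dvdnP[v]; rewrite zE; lia.
set y := a ^ _ in y1 *.
have [t yE] : exists t, y = 1 + l * t.
  exists (y %/ l); rewrite {1}(divn_eq y l) y1 modn_small // addnC mulnC //.
have yX i : exists q, y ^ i = 1 + i * (l * t) + l ^ 2 * q.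
  elim: i => [|i [q qE]]; first by exists 0; rewrite muln0.
  exists (q * y + i * t * t); rewrite expnSr qE {1}yE; rewrite yE; lia.
have [q ->] : exists q, \sum_(i < l) y ^ i = l + l * t * 'C(l, 2) + l ^ 2 * q.
  suff /(_ l) : forall j, exists q,
    \sum_(i < j) y ^ i = j + l * t * (\sum_(0 <= i < j) i) + l ^ 2 * q by rewrite bin2_sum.
  elim=> [|j [q IHj]]; first by exists 0; rewrite big_ord0 big_geq // !muln0.
  have [q' qE] := yX j; exists (q + q').
  rewrite big_ord_recr IHj qE big_nat_recr //=; lia.
have /dvdnP[u ->] : l %| 'C(l, 2).
  by apply: prime_dvd_bin; rewrite //= ltn_neqAle eq_sym l_neq2.
rewrite (dvdn_addl _ (dvdn_mulr q (dvdnn (l ^ 2)))).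
have l2 : l ^ 2 %| l * t * (u * l) by apply/dvdnP; exists (t * u); lia.
by rewrite (dvdn_addl _ l2) -[X in _ %| X]expn1 dvdn_Pexp2l.
Qed.

(** If no prime factor of c is primitive, then c is a single prime l and N = e * l^(k+1) with e < l;
    but then 2 ^ totient N exceeds l = c, against [c_ge]. *)
Lemma primitive_prime_divisor :
  exists l, [/\ prime l, l %| (a ^ N).-1 &
    forall d, 0 < d < N -> ~~ (l %| (a ^ d).-1)].
Proof.
have c_gt1 : 1 < c.
  apply: leq_trans c_ge; rewrite -{1}(expn0 2) ltn_exp2l //.
  by rewrite totient_gt0.
have cN : c %| (a ^ N).-1.
  exact: dvdn_trans (dvdn_mulr _ (dvdnn c)) (c_dvd (dvd1n N) (ltnW N_gt2)).
pose l := pdiv c.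
have l_pr : prime l by apply: pdiv_prime.
have lc : l %| c by apply: pdiv_dvd.
have [/existsP[l' /andP[/andP[l'_pr l'c] /forallP prim]]|] :=
  boolP [exists l' : 'I_c.+1, (prime l' && (l' %| c)) &&
    [forall d : 'I_N, (0 < d) ==> ~~ (l' %| (a ^ d).-1)]].
  exists l'; split=> //; first exact: dvdn_trans cN.
  by move=> d /andP[d0 dN]; have /implyP := prim (Ordinal dN); apply.
move=> /existsPn np.
have nonprim l' : prime l' -> l' %| c ->
    exists e k, [/\ N = e * l' ^ k.+1, e < l' & a ^ (N %/ l') = 1 %[mod l']].
  move=> l'_pr l'c; have l'lt : l' < c.+1 by rewrite ltnS dvdn_leq // ltnW.
  have := np (Ordinal l'lt); rewrite /= l'_pr l'c => /forallPn[d].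
  rewrite negb_imply negbK => /andP[d_gt0 ld].
  by apply: (nonprimitive_factor l'_pr l'c _ ld); rewrite d_gt0 /=.
have [e [k [NE ltel y1]]] := nonprim l l_pr lc.
have e_gt0 : 0 < e by move: N_gt0; rewrite NE muln_gt0 => /andP[].
have l2 := nonprimitive_square l_pr NE ltel y1.
have cl : c = l.
  (* Another prime factor r of c divides N, hence e, so r <= e < l, whereas l is the least prime
     factor of c. *)
  have cE : c = l ^ logn l c.
    rewrite -(p_part l c); apply/esym/part_pnat_id/pnatP; first exact: ltnW.
    move=> r r_pr rc; rewrite inE; apply/idPn => r_neq.
    have [e' [k' [NE' _ _]]] := nonprim r r_pr rc.
    have: r %| N by rewrite NE' expnS mulnCA dvdn_mulr.
    rewrite NE Euclid_dvdM // Euclid_dvdX // andbT (dvdn_prime2 r_pr l_pr) (negPf r_neq).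
    rewrite orbF => /(dvdn_leq e_gt0); rewrite leqNgt (leq_trans ltel) //.
    by apply: pdiv_min_dvd => //; apply: prime_gt1.
  have : logn l c <= 1 by rewrite leqNgt; apply: contra l2; rewrite cE -pfactor_dvdn ?expn_gt0 ?prime_gt0 // pfactorK //.
  have : 0 < logn l c by rewrite logn_gt0 mem_primes l_pr lc ltnW.
  by rewrite cE pfactorK //; case: (logn l c) => [|[|?]].
have co_el : coprime e (l ^ k.+1).
  rewrite coprimeXr // coprime_sym prime_coprime //.
  by apply/negP => /(dvdn_leq e_gt0); rewrite leqNgt ltel.
have := c_ge; rewrite {1}NE totient_coprime // totient_pfactor // cl leqNgt.
case/negP.
have l_le : l <= 2 ^ l.-1 by rewrite -{1}(prednK (prime_gt0 l_pr)) ltn_expl.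
have [l_2 | l_neq2] := eqVneq l 2.
  move: NE ltel; rewrite l_2; case: e e_gt0 {co_el} => [|[|?]] // _ NE _.
  rewrite mul1n /= mul1n; apply: (@leq_trans (2 ^ 2)) => //.
  rewrite leq_exp2l //; move: N_gt2; rewrite NE mul1n; case: (k) => //= k' _.
  by rewrite expnS leq_pmulr // expn_gt0.
have l_gt2 : 2 < l by rewrite ltn_neqAle eq_sym l_neq2 prime_gt1.
apply: (@leq_trans (2 ^ l.-1)).
  rewrite -(subnK l_gt2) addn3 /= !expnS mulnA (@leq_trans (4 * (l - 3).+1)) //.
    by rewrite mulnS -[_.+4]/(4 + (l - 3)) leq_add2l leq_pmull.
  by rewrite leq_pmul2l // ltn_expl.
by rewrite leq_exp2l // mulnCA leq_pmulr // muln_gt0 totient_gt0 e_gt0 expn_gt0 prime_gt0.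
Qed.
End Zsigmondy.

Lemma exists_primitive_prime_divisor (a N : nat) : (2 < a)%N -> (2 < N)%N ->
  exists l, [/\ prime l, l %| (a ^ N).-1 &
    forall d, (0 < d < N)%N -> ~~ (l %| (a ^ d).-1)].
Proof.
move=> a_gt2 N_gt2; have [c c_ge c_dvd] := cyclotomic_value a_gt2 N_gt2.
exact: primitive_prime_divisor a_gt2 N_gt2 c_ge c_dvd.
Qed.

(** * The symplectic group *)

Section Symplectic.
Local Open Scope ring_scope.
Variables (p m : nat).
Hypotheses (p_pr : prime p) (m_gt0 : (0 < m)%N).

Local Notation Fp := 'F_p.
Local Notation d := (2 * m).-1.+1.
Local Notation J := (sympJ Fp m d).

Let dE : d = (m + m)%N. Proof. by rewrite prednK ?muln_gt0 ?m_gt0 // mul2n addnn. Qed.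

(** The two halves of the coordinates: [sympJ] pairs position i with position m + i. *)
Definition lo (i : 'I_m) : 'I_d := inord i.
Definition hi (i : 'I_m) : 'I_d := inord (m + i).

Lemma lo_val i : lo i = i :> nat.
Proof. by rewrite inordK // dE ltn_addr. Qed.

Lemma hi_val i : hi i = (m + i)%N :> nat.
Proof. by rewrite inordK // dE ltn_add2l. Qed.

Lemma sum_lohi (V : nmodType) (G : 'I_d -> V) :
  \sum_i G i = \sum_i (G (lo i)) + \sum_i (G (hi i)).
Proof.
rewrite (eq_bigr (fun i : 'I_d => G (inord i))) => [|i _]; last by rewrite inord_val.
rewrite -(big_mkord xpredT (fun i => G (inord i))) (@big_cat_nat _ _ _ m) //=; last first.
  by rewrite dE leq_addr.
congr (_ + _); first by rewrite big_mkord.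
have -> : index_iota m d = index_iota (0 + m) (m + m) by rewrite -dE.
by rewrite big_addn addnK big_mkord; apply: eq_bigr => i _; rewrite addnC.
Qed.

Definition spform (u v : 'cV[Fp]_d) : Fp := (u^T *m J *m v) 0 0.

Lemma spformE u v : spform u v =
  \sum_i (u (lo i) 0 * v (hi i) 0 - u (hi i) 0 * v (lo i) 0).
Proof.
have Jll i j : J (lo i) (lo j) = 0.
  by rewrite mxE !lo_val ltn_ord leqNgt ltn_ord /= ltn_eqF // ltn_addl.
have Jhh i j : J (hi i) (hi j) = 0.
  rewrite mxE !hi_val ltnNge leq_addr /=.
  by case: eqP => // ij; have := ltn_ord i; lia.
have Jlh i j : J (lo i) (hi j) = (i == j)%:R.
  rewrite mxE !lo_val !hi_val ltn_ord leqNgt ltn_ord /= -val_eqE /=.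
  by rewrite [(i + m)%N]addnC eqn_add2l eq_sym; case: eqP.
have Jhl i j : J (hi i) (lo j) = - (i == j)%:R.
  rewrite mxE !lo_val !hi_val ltnNge leq_addr /= -val_eqE /=.
  by rewrite [(m + i)%N]addnC eqn_add2r; case: eqP => // _; rewrite oppr0.
rewrite /spform -mulmxA mxE sum_lohi.
rewrite sumrB; congr (_ + _).
  apply: eq_bigr => i _; rewrite !mxE sum_lohi; congr (_ * _).
  rewrite [X in X + _]big1 => [|j _]; last by rewrite Jll mul0r.
  rewrite add0r (bigD1 i) //= Jlh eqxx mul1r big1 ?addr0 // => j ji.
  by rewrite Jlh eq_sym (negPf ji) mul0r.
rewrite -sumrN; apply: eq_bigr => i _; rewrite !mxE sum_lohi -mulrN; congr (_ * _).
rewrite [X in _ + X]big1 => [|j _]; last by rewrite Jhh mul0r.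
rewrite addr0 (bigD1 i) //= Jhl eqxx mulN1r big1 ?addr0 // => j ji.
by rewrite Jhl eq_sym (negPf ji) oppr0 mul0r.
Qed.

Lemma spform_alt u : spform u u = 0.
Proof. by rewrite spformE big1 // => i _; rewrite mulrC subrr. Qed.

Lemma spformN u v : spform v u = - spform u v.
Proof.
by rewrite !spformE -sumrN; apply: eq_bigr => i _; rewrite opprB mulrC [X in _ - X]mulrC.
Qed.

Lemma spformDr u v w : spform u (v + w) = spform u v + spform u w.
Proof. by rewrite /spform mulmxDr mxE. Qed.

Lemma spformDl u v w : spform (u + v) w = spform u w + spform v w.
Proof. by rewrite /spform linearD !mulmxDl mxE. Qed.

Lemma spformZr a u v : spform u (a *: v) = a * spform u v.
Proof. by rewrite /spform -scalemxAr mxE. Qed.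

Lemma spformZl a u v : spform (a *: u) v = a * spform u v.
Proof. by rewrite /spform linearZ -!scalemxAl mxE. Qed.

(** Pairing u with the basis vector at [hi i] reads off coordinate [lo i], and the reverse up to
    sign. *)
Lemma spform_nondeg u : u != 0 -> exists v, spform u v != 0.
Proof.
move=> u_neq0; apply/existsP; apply: contraNT u_neq0 => /existsPn u0.
have u0' v : spform u v = 0 by apply/eqP; rewrite -[_ == _]negbK u0.
have deltaE (i j : 'I_d) : (delta_mx i 0 : 'cV[Fp]_d) j 0 = (j == i)%:R.
  by rewrite mxE eqxx andbT.
have lohi i j : (lo i == hi j) = false.
  by apply/negP => /eqP/(congr1 val); rewrite /= lo_val hi_val => /eqP; rewrite ltn_eqF // ltn_addr.
have lo_inj i j : (lo i == lo j) = (i == j) by rewrite -!val_eqE /= !lo_val.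
have hi_inj i j : (hi i == hi j) = (i == j) by rewrite -!val_eqE /= !hi_val eqn_add2l.
suff uz i : u (lo i) 0 = 0 /\ u (hi i) 0 = 0.
  (* Counting nonzero coordinates lets [sum_lohi] do the case split on the index. *)
  have: \sum_i (u i 0 != 0 : nat) = 0%N.
    by rewrite sum_lohi !big1 // => i _; case: (uz i) => l0 h0; rewrite ?l0 ?h0 eqxx.
  move=> /eqP; rewrite sum_nat_eq0 => /forallP uz'.
  apply/eqP/colP => i; rewrite mxE; apply/eqP; have := uz' i.
  by rewrite implyTb eqb0 negbK.
split.
  have := u0' (delta_mx (hi i) 0); rewrite spformE (bigD1 i) //= !deltaE eqxx.
  rewrite lohi mulr0 mulr1 subr0 big1 ?addr0 // => j ji.
  by rewrite !deltaE lohi hi_inj (negPf ji) !mulr0 subr0.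
have := u0' (delta_mx (lo i) 0); rewrite spformE (bigD1 i) //= !deltaE eqxx.
rewrite eq_sym lohi mulr0 mulr1 sub0r big1 ?addr0 => [/eqP|j ji].
  by rewrite oppr_eq0 => /eqP.
by rewrite !deltaE eq_sym lohi lo_inj (negPf ji) !mulr0 subr0.
Qed.

Lemma Sp_spformP (g : {'GL_(2 * m)['F_p]}) :
  reflect (forall u v, spform (GLval g *m u) (GLval g *m v) = spform u v) (g \in Sp m p).
Proof.
rewrite inE; apply: (iffP eqP) => [gJ u v | gP].
  by rewrite /spform trmx_mul !mulmxA -(mulmxA _ _ J) -(mulmxA _ (_ *m J)) gJ.
apply/matrixP => i j; have := gP (delta_mx i 0) (delta_mx j 0).
rewrite /spform trmx_mul !mulmxA -(mulmxA _ _ J) -(mulmxA _ (_ *m J)).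
by rewrite trmx_delta -!rowE -!colE !mxE.
Qed.

Lemma group_set_Sp : group_set (Sp m p).
Proof.
apply/group_setP; split=> [|g h /Sp_spformP gP /Sp_spformP hP].
  by apply/Sp_spformP => u v; rewrite !mul1mx.
by apply/Sp_spformP => u v; rewrite -!mulmxA gP hP.
Qed.
Canonical Sp_group := Group group_set_Sp.

(** A vector killed by M is orthogonal to everything, since M preserves the form; nondegeneracy
    makes it zero. *)
Lemma spform_preserving_unitmx (M : 'M[Fp]_d) :
  (forall u v, spform (M *m u) (M *m v) = spform u v) -> M \in unitmx.
Proof.
move=> MP; rewrite -unitmx_tr -row_free_unit; apply/inj_row_free => v vM.
apply: trmx_inj; apply/eqP; rewrite trmx0; apply: contraT.
case/spform_nondeg => w; rewrite -MP -[M]trmxK -trmx_mul vM trmx0.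
by rewrite -(scale0r 0) spformZl mul0r eqxx.
Qed.

(* If B(u,v) != 0, the transvection x |-> x + c B(x,w) w with w = v - u and c = 1 / B(u,v) maps u to v; otherwise go through a vector orthogonal to neither. *)
Lemma Sp_transitive (u v : 'cV[Fp]_d) : u != 0 -> v != 0 ->
  exists2 g : {'GL_(2 * m)['F_p]}, g \in Sp m p & GLval g *m u = v.
Proof.
have mkSp (M : 'M[Fp]_d) (MP : forall u v, spform (M *m u) (M *m v) = spform u v) :
    exists2 g : {'GL_(2 * m)['F_p]}, g \in Sp m p & GLval g = M.
  exists (Sub M (spform_preserving_unitmx MP)); last exact: SubK.
  by apply/Sp_spformP => x y; rewrite SubK MP.
have step x y : spform x y != 0 ->
    exists2 g : {'GL_(2 * m)['F_p]}, g \in Sp m p & GLval g *m x = y.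
  move=> xy; have [w wE] : {w | w = y - x} by exists (y - x).
  pose c := (spform x y)^-1.
  pose M : 'M[Fp]_d := 1%:M - c *: (w *m (w^T *m J)).
  have ME z : M *m z = z + (c * spform z w) *: w.
    rewrite mulmxBl mul1mx -scalemxAl; congr (_ + _); rewrite -mulmxA.
    rewrite [_ *m J *m z]mx11_scalar -/(spform w z) mul_mx_scalar scalerA -scaleNr.
    by rewrite (spformN z w) mulrN opprK.
  have [|g gS gM] := mkSp M.
    move=> z s; rewrite !ME !(spformDl, spformDr, spformZl, spformZr) spform_alt.
    rewrite (spformN s w).
    by ring.
  exists g => //; rewrite gM ME wE /c spformDr -scaleN1r spformZr spform_alt.
  by rewrite mulr0 addr0 mulVf // scale1r addrC scaleN1r addrNK.
move=> /spform_nondeg[w1 uw1] /spform_nondeg[w2 vw2].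
have [w uw wv] : exists2 w, spform u w != 0 & spform w v != 0.
  have sN x : (spform x v != 0) = (spform v x != 0) by rewrite spformN oppr_eq0.
  have [vw1|] := eqVneq (spform v w1) 0; last by exists w1; rewrite ?sN.
  have [uw2|] := eqVneq (spform u w2) 0; last by exists w2; rewrite ?sN.
  by exists (w1 + w2); rewrite ?sN spformDr ?uw2 ?vw1 ?addr0 ?add0r.
have [g gS gu] := step _ _ uw; have [h hS hw] := step _ _ wv.
by exists (h * g)%g; rewrite ?groupM //= -mulmxA gu hw.
Qed.

(** By transitivity the nonzero vectors form one orbit, and its length divides the group order. *)
Lemma dvdn_card_Sp : ((p ^ (2 * m)).-1 %| #|Sp m p|)%N.
Proof.
(* The inverse turns left multiplication into a right action. *)
pose to (x : 'cV[Fp]_d) (g : {'GL_(2 * m)['F_p]}) := GLval (g^-1)%g *m x.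
have to1 : to^~ 1%g =1 id by move=> x; rewrite /to invg1 mul1mx.
have toM x : act_morph to x by move=> g h; rewrite /to invMg mulmxA.
pose act := TotalAction to1 toM.
pose x0 : 'cV[Fp]_d := const_mx 1.
have x0_neq0 : x0 != 0 by apply/eqP => /matrixP/(_ 0 0)/eqP; rewrite !mxE oner_eq0.
have -> : ((p ^ (2 * m)).-1 = #|orbit act (Sp m p) x0|)%N.
  have -> : orbit act (Sp m p) x0 = [set x | x != 0].
    apply/setP => x; rewrite inE; apply/orbitP/idP => [[g gS <-]|x_neq0].
      apply: contra x0_neq0; rewrite /= /to => /eqP/(congr1 (mulmx (GLval g))).
      by rewrite mulmxA -[_ *m GLval _]/(GLval (g * g^-1)%g) mulgV mul1mx mulmx0 => ->.
    have [g gS gx] := Sp_transitive x0_neq0 x_neq0.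
    by exists (g^-1)%g; rewrite ?groupV //= /to invgK.
  have := cardC1 (0 : 'cV[Fp]_d); rewrite card_mx card_Fp // muln1 prednK ?muln_gt0 ?m_gt0 //.
  by move=> <-; apply: eq_card => x; rewrite !inE.
by rewrite dvdn_orbit.
Qed.
End Symplectic.

(** * Decomposition of the matrix algebra under a projective representation *)

Section ProjectiveRepresentation.
Local Open Scope ring_scope.
Variables (F : finFieldType) (gT : finGroupType) (A : {group gT}) (n : nat).
Variables (W : gT -> 'M[F]_n.+1) (X : gT -> gT -> F).
Hypothesis W_unit : {in A, forall x, W x \is a GRing.unit}.
Hypothesis W_mul : {in A &, forall x y, exists c, W x * W y = c *: W (x * y)%g}.
Hypothesis W_comm : {in A &, forall x y, W x * W y = X x y *: (W y * W x)}.
Hypothesis X_nondeg : {in A, forall x, {in A, forall y, X y x = 1} -> x = 1%g}.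
Hypothesis cardA_neq0 : #|A|%:R != 0 :> F.

Let WW_neq0 : {in A &, forall x y, W x * W y != 0}.
Proof.
move=> x y xA yA; apply: contraTneq (oner_neq0 'M[F]_n.+1) => W0.
rewrite -(mulrV (W_unit xA)) -[W x]mulr1 -(mulrV (W_unit yA)) mulrA W0.
by rewrite !mul0r eqxx.
Qed.

Let scale_cancel a b (M : 'M[F]_n.+1) : M != 0 -> a *: M = b *: M -> a = b.
Proof.
move=> M0 /eqP; rewrite -subr_eq0 -scalerBl scaler_eq0 (negPf M0) orbF subr_eq0.
by move/eqP.
Qed.

Let X_neq0 : {in A &, forall x y, X x y != 0}.
Proof.
move=> x y xA yA; apply: contraNneq (WW_neq0 xA yA) => X0.
by rewrite W_comm // X0 scale0r.
Qed.

Let X_mull : {in A & &, forall x y z, X (x * y)%g z = X x z * X y z}.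
Proof.
move=> x y z xA yA zA; have [c Wc] := W_mul xA yA.
have c0 : c != 0 by apply: contraNneq (WW_neq0 xA yA) => c0; rewrite Wc c0 scale0r.
have e1 : X (x * y)%g z *: (c *: (W z * W (x * y)%g)) = W x * W y * W z.
  by rewrite scalerA mulrC -scalerA -(W_comm (groupM xA yA) zA) scalerAl -Wc.
have e2 : W x * W y * W z = (X x z * X y z) *: (c *: (W z * W (x * y)%g)).
  rewrite scalerAr -Wc -mulrA (W_comm yA zA) -scalerAr !mulrA (W_comm xA zA).
  by rewrite -scalerAl scalerA mulrC.
apply: (@scale_cancel _ _ (c *: (W z * W (x * y)%g))); last by rewrite e1.
by rewrite scaler_eq0 (negPf c0) WW_neq0 ?groupM.
Qed.

Let X_swap : {in A &, forall x y, X y x = (X x y)^-1}.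
Proof.
move=> x y xA yA; apply: (mulfI (X_neq0 xA yA)); rewrite mulfV ?X_neq0 //.
apply: (@scale_cancel _ _ (W x * W y)); first exact: WW_neq0.
by rewrite -scalerA -(W_comm yA xA) -(W_comm xA yA) scale1r.
Qed.

Let X1l : {in A, forall x, X 1%g x = 1}.
Proof.
move=> x xA; apply: (mulfI (X_neq0 (group1 A) xA)).
by rewrite -X_mull // mulg1 mulr1.
Qed.

Let X_mulr : {in A & &, forall x y z, X x (y * z)%g = X x y * X x z}.
Proof.
move=> x y z xA yA zA.
by rewrite X_swap ?groupM // X_mull // invfM -!X_swap.
Qed.

Let shift_sum (V : nmodType) t (G : gT -> V) : t \in A ->
  \sum_(y in A) G y = \sum_(y in A) G (t * y)%g.
Proof.
move=> tA; rewrite (reindex_inj (mulgI t)) /=.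
by apply: eq_bigl => y; rewrite groupMl.
Qed.

(** Orthogonality of characters: the summand is X(y, x0^-1 x). When X(-, z) takes a value X(t, z)
    other than 1, translating by t multiplies its sum by that value, so the sum is 0. *)
Let X_sum : {in A &, forall x x0, \sum_(y in A) X y x * X x0 y = #|A|%:R *+ (x == x0)}.
Proof.
have key: {in A, forall z, \sum_(y in A) X y z = #|A|%:R *+ (z == 1%g)}.
  move=> z zA; have [-> | z1] := eqVneq z 1%g.
    rewrite (eq_bigr (fun=> 1)) => [|y yA]; first by rewrite sumr_const.
    by rewrite X_swap ?X1l ?invr1.
  have [/exists_inP[t tA tz]|] := boolP [exists t in A, X t z != 1].
    apply/eqP; have: (1 - X t z) * (\sum_(y in A) X y z) = 0.
      rewrite mulrBl mul1r mulr_sumr (shift_sum (X^~ z) tA) -sumrB big1 // => y yA.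
      by rewrite X_mull // subrr.
    by move=> /eqP; rewrite mulf_eq0 subr_eq0 eq_sym (negPf tz).
  move=> /exists_inPn no; case/eqP: z1; apply: X_nondeg => // y yA.
  by apply/eqP; have := no _ yA; rewrite negbK.
move=> x x0 xA x0A.
have XX y : y \in A -> X y x * X x0 y = X y (x0^-1 * x)%g.
  move=> yA; rewrite X_mulr ?groupV // mulrC; congr (_ * _).
  apply: (mulfI (X_neq0 yA x0A)); rewrite -X_mulr ?groupV // mulgV.
  by rewrite X_swap // mulVf ?X_neq0 // X_swap // X1l ?invr1.
rewrite (eq_bigr _ XX) key ?groupM ?groupV //.
by rewrite -eq_mulVg1 eq_sym.
Qed.

Definition commutes_with_W (M : 'M[F]_n.+1) := {in A, forall x, W x * M = M * W x}.

(** Conjugate the relation by each W_y and sum against X(x0, y): orthogonality isolates |A| W_x0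
    d_x0. *)
Lemma commutant_sum_eq0 d : {in A, forall x, commutes_with_W (d x)} ->
  \sum_(x in A) W x * d x = 0 -> {in A, forall x, d x = 0}.
Proof.
move=> dC sum0 x0 x0A.
have: \sum_(y in A) X x0 y *: (W y * (\sum_(x in A) W x * d x) * (W y)^-1) = 0.
  by apply: big1 => y yA; rewrite sum0 mulr0 mul0r scaler0.
rewrite (eq_bigr (fun y => \sum_(x in A) (X y x * X x0 y) *: (W x * d x))); last first.
  move=> y yA; rewrite mulr_sumr mulr_suml scaler_sumr; apply: eq_bigr => x xA.
  rewrite mulrA (W_comm yA xA) -!scalerAl -[W x * W y * d x]mulrA (dC x xA y yA).
  by rewrite mulrA mulrK ?W_unit // scalerA mulrC.
rewrite exchange_big /= (bigD1 x0) //= [X in _ + X]big1 ?addr0 => [|x /andP[xA xx0]].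
  rewrite -scaler_suml X_sum // eqxx => /eqP; rewrite scaler_eq0 (negPf cardA_neq0).
  by move=> /eqP W0; rewrite -[d x0](mulKr (W_unit x0A)) W0 mulr0.
by rewrite -scaler_suml X_sum // (negPf xx0) scale0r.
Qed.

(** The Fourier component N_x = sum_y X(x,y) W_y M W_y^-1 commutes with every W_z up to the same
    scalar as W_x does, so W_x^-1 N_x lies in the commutant. By orthogonality the N_x add up to |A|
    M. *)
Lemma commutant_decomposition M : exists2 d,
  {in A, forall x, commutes_with_W (d x)} & M = \sum_(x in A) W x * d x.
Proof.
pose N x := \sum_(y in A) X x y *: (W y * M * (W y)^-1).
have NC z x : z \in A -> x \in A -> W z * N x = X z x *: (N x * W z).
  move=> zA xA; rewrite /N mulr_sumr mulr_suml scaler_sumr.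
  rewrite (shift_sum (fun y => X z x *: _) zA) /=; apply: eq_bigr => y yA.
  have [c Wc] := W_mul zA yA.
  rewrite X_mulr // -[in RHS]scalerAl scalerA mulrA (X_swap xA zA) mulVf ?X_neq0 // mul1r.
  rewrite -scalerAr; congr (_ *: _).
  apply: (mulIr (W_unit yA)); rewrite -!mulrA mulVr ?W_unit // mulr1 mulrA Wc.
  by rewrite -!scalerAr mulVr ?W_unit ?groupM // mulr1 -scalerAl.
exists (fun x => #|A|%:R^-1 *: ((W x)^-1 * N x)).
  move=> x xA z zA; rewrite -scalerAr -scalerAl; congr (_ *: _).
  apply: (mulrI (W_unit xA)); rewrite mulrA (W_comm xA zA) -scalerAl -mulrA.
  rewrite [W x * (_ * N x)]mulrA mulrV ?W_unit // mul1r (NC z x) // scalerA.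
  rewrite (X_swap zA xA) mulVf ?X_neq0 // scale1r.
  by rewrite !mulrA mulrV ?W_unit // mul1r.
rewrite (eq_bigr (fun x => #|A|%:R^-1 *: N x)) => [|x xA]; last first.
  by rewrite -scalerAr mulrA mulrV ?W_unit // mul1r.
rewrite -scaler_sumr exchange_big /= (bigD1 1%g) //= [X in _ + X]big1 ?addr0 => [|y /andP[yA y1]].
  rewrite -scaler_suml (eq_bigr (fun x => X x 1%g * X 1%g x)) => [|x xA]; last by rewrite X1l ?mulr1.
  rewrite X_sum // eqxx scalerA mulVf // scale1r.
  have [c Wc] := W_mul (group1 A) (group1 A).
  have W1 : W 1%g = c%:A.
    by apply: (mulrI (W_unit (group1 A))); rewrite Wc mulg1 -scalerAr mulr1.
  have WM : W 1%g * M = M * W 1%g by rewrite W1 -scalerAl -scalerAr mul1r mulr1.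
  by rewrite WM mulrK ?W_unit.
rewrite -scaler_suml.
rewrite (eq_bigr (fun x => X x y * X 1%g x)) => [|x xA]; last by rewrite X1l ?mulr1.
by rewrite X_sum // (negPf y1) scale0r.
Qed.

(** The two preceding lemmas make the matrix algebra the direct sum of the spaces W_x D, all of
    dimension dim D because W_x is invertible. *)
Lemma dim_commutant : exists2 D : {vspace 'M[F]_n.+1},
  (forall M, M \in D <-> commutes_with_W M) & (#|A| * \dim D = n.+1 ^ 2)%N.
Proof.
pose D := (\bigcap_(x in A) lker (linfun (mulmx (W x) \- mulmxr (W x))))%VS.
have DP M : reflect (commutes_with_W M) (M \in D).
  rewrite memvE; apply: (iffP subv_bigcapP) => [MD x xA | MC x xA].
    have := MD x xA; rewrite -memvE memv_ker lfunE /= subr_eq0 => /eqP //.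
  by rewrite -memvE memv_ker lfunE /= [W x *m M](MC x xA) subrr.
pose WD x := (linfun (mulmx (W x)) @: D)%VS.
have dimWD x : x \in A -> \dim (WD x) = \dim D.
  move=> xA; apply: limg_dim_eq; apply/eqP; rewrite -subv0; apply/subvP => M.
  rewrite memv_cap memv_ker lfunE /= memv0 => /andP[_ /eqP WM0].
  by rewrite -[M](mulKr (W_unit xA)) [W x * M]WM0 mulr0.
have dWD : directv (\sum_(x in A) WD x).
  apply/directv_sum_independent => us us_WD sum0.
  have usP x : exists d, x \in A -> d \in D /\ us x = W x * d.
    have [xA | _] := boolP (x \in A); last by exists 0.
    by have /memv_imgP[d dD usE] := us_WD x xA; exists d => _; rewrite lfunE in usE.
  have [d dE] := fin_all_exists usP.
  move=> x xA; have [_ ->] := dE x xA; rewrite (commutant_sum_eq0 (d := d)) ?mulr0 //.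
    by move=> y yA; apply/DP; case: (dE y yA).
  by rewrite (eq_bigr us) => [|y yA]; [exact: sum0 | case: (dE y yA)].
have WD_full : (\sum_(x in A) WD x)%VS = fullv.
  apply: subv_anti; rewrite subvf /=; apply/subvP => M _.
  have [d dC ->] := commutant_decomposition M.
  apply: memv_sumr => x xA; apply/memv_imgP; exists (d x); first exact/DP/dC.
  by rewrite lfunE.
exists D => [M|]; first by split=> /DP.
have <- : \dim (\sum_(x in A) WD x) = (n.+1 ^ 2)%N.
  by rewrite WD_full dimvf /dim /= -mulnn.
by rewrite (directvP dWD) /= (eq_bigr (fun=> \dim D)) // sum_nat_const.
Qed.

Lemma card_dvdn_sqr_dim : (#|A| %| n.+1 ^ 2)%N.
Proof. by have [D _ <-] := dim_commutant; apply: dvdn_mulr. Qed.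

(** The dimension count leaves a commutant of dimension 1, spanned by the identity. *)
Lemma commutant_scalar M : #|A| = (n.+1 ^ 2)%N -> commutes_with_W M ->
  exists c, M = c%:M.
Proof.
move=> oA MC; have [D DP dimD] := dim_commutant; have MD := (DP M).2 MC.
have /eqP dimD1 : \dim D == 1%N.
  by rewrite -(eqn_pmul2l (cardG_gt0 A)) dimD oA muln1.
have D1 : 1%:M \in D by apply/DP => x _; rewrite -[1%:M]/(1 : 'M_n.+1) mulr1 mul1r.
have DE : (<[1%:M : 'M[F]_n.+1]> == D)%VS.
  by rewrite eqEdim -memvE D1 dimD1 dim_vline -[1%:M]/(1 : 'M_n.+1) oner_neq0.
move: MD; rewrite -(eqP DE) => /vlineP[c ->].
by exists c; rewrite scalemx1.
Qed.

(** Write h = sum_x W_x d_x. Comparing components in the hypothesis gives X(-, x) = psi whenever d_x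
    is nonzero, and nondegeneracy allows only one such x. *)
Lemma normalizer_decomposition h (psi : gT -> F) : h != 0 ->
  {in A, forall y, W y * h = psi y *: (h * W y)} ->
  exists x d, [/\ x \in A, commutes_with_W d & h = W x * d].
Proof.
move=> h0 hW; have [d dC hE] := commutant_decomposition h.
have /existsP[x0 /andP[x0A dx0]] : [exists x, (x \in A) && (d x != 0)].
  apply: contraNT h0 => /existsPn no; rewrite hE big1 // => x xA.
  by have := no x; rewrite xA negbK => /eqP ->; rewrite mulr0.
pose e y x := (X y x - psi y) *: d x.
have eq0 y : y \in A -> {in A, forall x, e y x = 0}.
  move=> yA; apply: commutant_sum_eq0 => [x xA z zA|].
    by rewrite /e -scalerAr -scalerAl (dC x xA z zA).
  have /eqP : W y * h - psi y *: (h * W y) = 0 by rewrite hW ?subrr.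
  rewrite {1 2}hE mulr_sumr mulr_suml scaler_sumr -sumrB => /eqP sum0.
  apply: (mulIr (W_unit yA)); rewrite mul0r mulr_suml; apply: etrans sum0.
  apply: eq_bigr => x xA; rewrite /e mulrA (W_comm yA xA) -scalerAr -scalerAl.
  by rewrite -scalerAl -[W x * W y * d x]mulrA (dC x xA y yA) mulrA -scalerBl.
have psiE x : x \in A -> d x != 0 -> {in A, forall y, X y x = psi y}.
  move=> xA dx y yA; have /eqP := eq0 y yA x xA.
  by rewrite scaler_eq0 (negPf dx) orbF subr_eq0 => /eqP.
exists x0, (d x0); split=> //; first exact: dC.
rewrite hE (bigD1 x0) //= [X in _ + X]big1 ?addr0 // => x /andP[xA xx0].
have [-> | dx] := eqVneq (d x) 0; first by rewrite mulr0.
case/eqP: xx0; apply/eqP; rewrite eq_sym eq_mulVg1; apply/eqP; apply: X_nondeg.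
  by rewrite groupM ?groupV.
move=> y yA; rewrite X_mulr ?groupV // (psiE x) // -(psiE x0 x0A dx0 y yA).
by rewrite -X_mulr ?groupV // mulVg X_swap // X1l ?invr1.
Qed.
End ProjectiveRepresentation.

(** * Lifting from PGL to matrices *)

Section ProjectiveLinear.
Local Open Scope ring_scope.
Variables (n : nat) (F : finFieldType).
Local Notation N := n.-1.+1.
Local Notation Z := ('Z('GL_n[F]))%g.

Lemma GLval_inj : injective (@GLval n F).
Proof. exact: val_inj. Qed.

Lemma GLvalM (g h : {'GL_n[F]}) : GLval (g * h)%g = GLval g * GLval h.
Proof. by []. Qed.

Lemma GLval_neq0 (g : {'GL_n[F]}) : GLval g != 0.
Proof. by apply: contraTneq (valP g) => /= ->; rewrite unitr0. Qed.

Lemma GLval_unit (g : {'GL_n[F]}) : GLval g \is a GRing.unit.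
Proof. exact: valP g. Qed.

Lemma exists_GL (M : 'M[F]_N) : M \is a GRing.unit -> exists g : {'GL_n[F]}, GLval g = M.
Proof. by move=> MU; exists (Sub M MU); apply: SubK. Qed.

Lemma GLscalar c : c != 0 -> exists2 g : {'GL_n[F]}, g \in Z & GLval g = c%:M.
Proof.
move=> c0; have cU : (c%:M : 'M[F]_N) \is a GRing.unit by rewrite -[_ \is a _]/(c%:M \in unitmx) unitmxE det_scalar unitrX ?unitfE.
have [g gc] := exists_GL cU; exists g => //.
apply/centerP; split; rewrite ?inE // => h _; apply: GLval_inj.
by rewrite !GLvalM gc; apply/esym/scalar_mxC.
Qed.

(** Commuting with the transvection 1 + E_ia forces entry (a, i) to vanish and the diagonal entries
    at a and i to agree. *)
Lemma mem_center_GL g : g \in Z -> exists2 c, c != 0 & GLval g = c%:M.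
Proof.
case/centerP=> _ gC; set M := GLval g.
have offdiag a i : a != i -> M a i = 0 /\ M a a = M i i.
  move=> ai; pose E (s : F) : 'M[F]_N := 1%:M + s *: delta_mx i a.
  have E2 : delta_mx i a *m delta_mx i a = 0 :> 'M[F]_N.
    by rewrite mul_delta_mx_cond (negPf ai) mulr0n.
  have EU : E 1 \is a GRing.unit.
    apply/unitrP; exists (E (-1)); rewrite /E scale1r scaleN1r -![_ * _]/(_ *m _).
    by split; rewrite mulmxDl !mulmxDr !mul1mx !mulmx1 ?mulmxN ?mulNmx E2 oppr0 addr0 ?addrNK ?subrK ?addrK.
  have [e eE] := exists_GL EU.
  have := congr1 (@GLval n F) (gC e (in_setT _)); rewrite !GLvalM eE -/M /E scale1r -![_ * _]/(_ *m _) mulmxDl mulmxDr mul1mx mulmx1.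
  move/addrI => comm.
  split.
    have := congr1 (fun A : 'M_N => A a a) comm; rewrite !mxE.
    rewrite (bigD1 i) //= big1 ?addr0 => [|j ji]; last by rewrite mxE (negPf ji) mulr0.
    rewrite big1 => [|j _]; last by rewrite mxE (negPf ai) mul0r.
    by rewrite mxE !eqxx mulr1.
  have := congr1 (fun A : 'M_N => A i a) comm; rewrite !mxE.
  rewrite (bigD1 i) //= big1 ?addr0 => [|j ji]; last by rewrite mxE (negPf ji) mulr0.
  rewrite (bigD1 a) //= big1 ?addr0 => [|j ja]; last by rewrite mxE (negPf ja) andbF mul0r.
  by rewrite !mxE !eqxx mulr1 mul1r.
have ME : M = (M 0 0)%:M.
  apply/matrixP => a i; rewrite mxE.
  have [-> | ai] := eqVneq a i; last by case: (offdiag a i ai).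
  rewrite mulr1n; have [-> // | i0] := eqVneq i 0.
  by case: (offdiag i 0 i0).
exists (M 0 0) => //; apply: contraNneq (GLval_neq0 g) => M0.
by rewrite -/M ME M0 raddf0.
Qed.

Lemma center_GL_norm g : g \in 'N(Z)%g.
Proof. by rewrite (subsetP (normal_norm (center_normal _))) ?inE. Qed.

Lemma coset_PGL (g : {'GL_n[F]}) : coset Z g \in PGL n F.
Proof. by apply: mem_quotient; rewrite inE. Qed.

Lemma mem_PGL (x : PGLtype n F) : x \in PGL n F.
Proof. by rewrite -(coset_reprK x) coset_PGL. Qed.

Lemma eq_cosetP (g h : {'GL_n[F]}) :
  coset Z g = coset Z h <-> exists2 c, c != 0 & GLval g = c *: GLval h.
Proof.
split=> [/(rcoset_kercosetP (center_GL_norm g) (center_GL_norm h))|[c c0 gh]].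
  case/rcosetP => z /mem_center_GL[c c0 zc] ->; exists c => //.
  by rewrite GLvalM zc; apply: mul_scalar_mx.
apply/(rcoset_kercosetP (center_GL_norm g) (center_GL_norm h)).
have [z zZ zc] := GLscalar c0; apply/rcosetP; exists z => //; apply: GLval_inj.
by rewrite gh GLvalM zc; symmetry; apply: mul_scalar_mx.
Qed.

Definition lift (x : PGLtype n F) : 'M[F]_N := GLval (repr x).

Lemma lift_unit x : lift x \is a GRing.unit.
Proof. exact: GLval_unit. Qed.

Lemma lift_coset g : exists2 c, c != 0 & GLval g = c *: lift (coset Z g).
Proof. by apply/eq_cosetP; rewrite coset_reprK. Qed.

Lemma lift_mul x y : exists2 c, c != 0 & lift x * lift y = c *: lift (x * y)%g.
Proof.
have [c c0 E] := lift_coset (repr x * repr y)%g; exists c => //.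
by rewrite /lift -GLvalM E coset_morphM ?center_GL_norm // !coset_reprK.
Qed.

(** For commuting x and y the commutator of the lifts is a scalar matrix, so one entry gives the
    scalar. *)
Definition lift_comm (x y : PGLtype n F) : F :=
  (lift x * lift y * (lift x)^-1 * (lift y)^-1) 0 0.

Lemma lift_commE x y : commute x y ->
  lift x * lift y = lift_comm x y *: (lift y * lift x).
Proof.
move=> xy; have [c c0 E] := lift_mul x y; have [b b0 E'] := lift_mul y x.
have XY : lift x * lift y = (c * b^-1) *: (lift y * lift x).
  by rewrite E E' scalerA mulfVK // xy.
rewrite /lift_comm {2}XY -!scalerAl mulrK ?lift_unit // mulrV ?lift_unit //.
by rewrite -[1]/(1%:M) scalemx1 mxE eqxx mulr1n.
Qed.
End ProjectiveLinear.

(** * Necessity *)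

Section PrimitivePrime.
Local Open Scope group_scope.

(** Modulo l, an l-group fixes as many points as R has. If p^a points are fixed, l divides p^(r-a) -
    1, so by primitivity r = a or r - a >= N; the last hypothesis rules out the second case. *)
Lemma pgroup_centralises_pnat_card (gT : finGroupType) (p l N : nat) (P R : {group gT}) (r : nat) :
  prime p -> prime l -> l.-group P -> P \subset 'N(R) -> #|R| = (p ^ r)%N ->
  (forall d, 0 < d < N -> ~~ (l %| (p ^ d).-1))%N ->
  (0 < N)%N -> (l %| (p ^ N).-1)%N ->
  ((r < N)%N \/ r = N /\ 'C_R(P) != 1%g) -> R \subset 'C(P).
Proof.
move=> p_pr l_pr lP nRP oR prim N_gt0 lN rN.
have fixm : #|R| = #|'C_R(P)| %[mod l].
  by rewrite -afixJ -(pgroup_fix_mod lP) // /actsP astabsJ.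
have [a a_le oC] : exists2 a, a <= r & #|'C_R(P)| = (p ^ a)%N.
  by apply/(dvdn_pfactor _ _ p_pr); rewrite -oR cardSg // subsetIl.
have co_lp : coprime l p.
  rewrite prime_coprime //; apply: contraL lN => lp.
  by rewrite -subn1 dvdn_subr ?expn_gt0 ?prime_gt0 ?dvdn_exp // dvdn1 gtn_eqF ?prime_gt1.
have : (l %| (p ^ (r - a)).-1)%N.
  move/eqP: fixm; rewrite oR oC eqn_mod_dvd ?leq_exp2l ?prime_gt1 //.
  rewrite -{1}(subnK a_le) expnD -{2}[(p ^ a)%N]mul1n -mulnBl Gauss_dvdl ?coprimeXr //.
  by rewrite subn1.
have [ra0 | ra_gt0] := posnP (r - a)%N.
  move=> _; have : 'C_R(P)%g == R.
    by rewrite eqEcard subsetIl oR oC leq_exp2l ?prime_gt1 // -subn_eq0 ra0.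
  by move/eqP <-; apply: subsetIr.
have [ra_lt | ra_ge] := ltnP (r - a)%N N.
  by rewrite (negPf (prim _ _)) // ra_gt0.
case: rN => [rN | [rN /negP[]]].
  by have := leq_ltn_trans (leq_subr a r) rN; rewrite ltnNge ra_ge.
rewrite trivg_card1 oC; case: (a) a_le ra_ge => // a' a_le; rewrite rN.
by rewrite leqNgt ltn_subrL N_gt0.
Qed.

(** Some l-element y of G acts nontrivially on L. If R were proper and nontrivial, y would
    centralise R, hence have nontrivial fixed points in L, hence centralise L. *)
Lemma primitive_prime_irreducible (gT : finGroupType) (p l N : nat) (G L R : {group gT}) :
  prime p -> prime l -> #|L| = (p ^ N)%N -> R \subset L ->
  G \subset 'N(L) -> G \subset 'N(R) ->
  (forall d, 0 < d < N -> ~~ (l %| (p ^ d).-1))%N -> (0 < N)%N -> (l %| (p ^ N).-1)%N ->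
  l %| #|(G / 'C_G(L))%g| -> R :=: 1%g \/ R :=: L.
Proof.
move=> p_pr l_pr oL sRL nLG nRG prim N_gt0 lN lG.
have [-> | R1] := eqVneq (R : {set gT}) 1%g; [by left | right; apply/eqP].
have nCG : G \subset 'N('C_G(L)) by rewrite normsI ?normG ?norms_cent.
have [xb xbG oxb] := Cauchy l_pr lG.
have /morphimP[x nx xG xE] := xbG.
(* Passing to the l-part of x keeps its image, which has order l. *)
pose y := x.`_l; have yG : y \in G by rewrite groupX.
have yE : coset 'C_G(L) y = xb.
  by rewrite morph_constt // -xE constt_p_elt // /p_elt oxb pnat_id.
have lY : l.-group <[y]> by rewrite -[_.-group _]/(l.-elt y) p_elt_constt.
have [r r_le oR] : exists2 r, r <= N & #|R| = (p ^ r)%N.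
  by apply/(dvdn_pfactor _ _ p_pr); rewrite -oL cardSg.
have sYG : <[y]> \subset G by rewrite cycle_subG.
have nY (H : {group gT}) : G \subset 'N(H) -> <[y]> \subset 'N(H) by apply: subset_trans.
rewrite eqEcard sRL oL oR leq_exp2l ?prime_gt1 // leqNgt; apply/negP => r_lt.
have cRY : R \subset 'C(<[y]>).
  by apply: (pgroup_centralises_pnat_card p_pr l_pr lY (nY _ nRG) oR prim N_gt0 lN); left.
have cLY : L \subset 'C(<[y]>).
  apply: (pgroup_centralises_pnat_card p_pr l_pr lY (nY _ nLG) oL prim N_gt0 lN); right; split=> //.
  by apply: contraNneq R1 => CL1; rewrite -subG1 -CL1 subsetI sRL.
have: y \in 'C_G(L)%g by rewrite inE yG -cycle_subG centsC.
move/coset_id; rewrite yE => xb1; move: oxb; rewrite xb1 order1 => l1.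
by move: l_pr; rewrite -l1.
Qed.
End PrimitivePrime.

(** * Commuting lifts and maximal tori *)

Section Toral.
Local Open Scope ring_scope.

(** The minimal polynomial divides X^p - c, which is separable because p and c are nonzero in K. *)
Lemma diagonalizable_root_scalar (K : closedFieldType) n (A : 'M[K]_n.+1) (p : nat) (c : K) :
  p%:R != 0 :> K -> c != 0 -> A ^+ p = c%:M -> diagonalizable A.
Proof.
move=> p0 c0 Ap; have p_gt0 : (0 < p)%N by case: (p) p0 => //; rewrite eqxx.
pose P : {poly K} := 'X^p - c%:P.
have [rs PE] := closed_field_poly_normal P.
have Pmonic : P \is monic by apply: monicXnsubC.
rewrite (monicP Pmonic) scale1r in PE.
apply/diagonalizableP; exists rs.
  rewrite -separable_prod_XsubC -PE /P unlock linearB /= derivXn derivC subr0.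
  rewrite -scaler_nat coprimepZr //; case: (p) p_gt0 => // p' _ /=.
  rewrite coprimep_sym; apply: coprimep_expl.
  rewrite coprimep_sym coprimepX.
  by rewrite rootE !hornerE expr0n /= sub0r oppr_eq0.
rewrite -PE; apply: mxminpoly_min.
by rewrite /P rmorphB /= horner_mx_C rmorphXn /= horner_mx_X Ap subrr.
Qed.

(** All matrices above L form a finite commuting family with scalar p-th powers, so they are
    diagonalizable over K, and simultaneously so. *)
Lemma toral_of_commuting n (F : finFieldType) (K : closedFieldType) (f : {rmorphism F -> K})
    p (L : {group PGLtype n F}) :
  p%:R != 0 :> F -> {in L, forall x, x ^+ p = 1}%g ->
  {in L &, forall x y, lift x * lift y = lift y * lift x} -> toral_in f L.
Proof.
move=> p0 Lp comm.
pose As := [seq map_mx f (GLval g) | g <- enum [set g | coset 'Z('GL_n[F])%g g \in L]].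
have AsP A : A \in As -> exists2 g, coset 'Z('GL_n[F])%g g \in L & A = map_mx f (GLval g).
  by case/mapP => g; rewrite mem_enum inE => gL ->; exists g.
have [P PU /allP PD] : codiagonalizable As.
  apply/codiagonalizableP; split=> [A B /AsP[g gL ->] /AsP[h hL ->] | A /AsP[g gL ->]].
    rewrite /comm_mx -!map_mxM; congr map_mx.
    have [c c0 ->] := lift_coset g; have [b b0 ->] := lift_coset h.
    rewrite -!scalemxAl -!scalemxAr !scalerA mulrC; congr (_ *: _).
    exact: comm.
  have gp : coset 'Z('GL_n[F])%g (g ^+ p)%g = coset 'Z('GL_n[F])%g 1%g.
    by rewrite morphX ?center_GL_norm // (Lp _ gL) morph1.
  have [c c0 gc] := (eq_cosetP _ _).1 gp.
  apply: (@diagonalizable_root_scalar _ _ _ p (f c)).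
  - by rewrite -(rmorph_nat f) fmorph_eq0.
  - by rewrite fmorph_eq0.
  have gX k : GLval (g ^+ k)%g = GLval g ^+ k.
    by elim: k => // k IH; rewrite expgS exprS GLvalM IH.
  rewrite -rmorphXn /= -gX gc.
  by rewrite -[GLval 1%g]/(1%:M) scalemx1 map_scalar_mx.
(* Simultaneous diagonalization conjugates as P M P^-1, [toral_in] as P^-1 M P. *)
exists (invmx P); first by rewrite unitmx_inv.
move=> g gL; rewrite invmxK -conjumx //.
by apply: PD; apply/mapP; exists g; rewrite ?mem_enum ?inE.
Qed.
End Toral.

(** * The radical of the commutator pairing *)

Section Radical.
Local Open Scope group_scope.
Variables (n : nat) (F : finFieldType) (L : {group PGLtype n F}).
Local Notation Z := 'Z('GL_n[F]).

Definition preGL : {group {'GL_n[F]}} := (coset Z @*^-1 L)%G.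

(** Realised as the image of the centre of the preimage of L, so that it is a group and its
    stability under the normaliser of L comes from the centre being characteristic. *)
Definition radical : {group PGLtype n F} := ('Z(preGL) / Z)%G.

Lemma mem_cosetpre_GL (A : {set PGLtype n F}) g :
  (g \in coset Z @*^-1 A) = (coset Z g \in A).
Proof. by rewrite inE center_GL_norm inE. Qed.

Lemma mem_preGL g : (g \in preGL) = (coset Z g \in L).
Proof. exact: mem_cosetpre_GL. Qed.

Lemma center_sub_preGL : Z \subset 'Z(preGL).
Proof.
apply/subsetP => z zZ; apply/centerP; split=> [|g _].
  by rewrite mem_preGL coset_id.
by case/centerP: zZ => _; apply; rewrite inE.
Qed.

Lemma preGL_quo : preGL / Z = L.
Proof. by apply: cosetpreK. Qed.

Lemma radical_sub : radical \subset L.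
Proof. by rewrite -preGL_quo quotientS ?subsetIl. Qed.

Lemma repr_preGL (x : PGLtype n F) : (repr x \in preGL) = (x \in L).
Proof. by rewrite mem_preGL coset_reprK. Qed.

Lemma mem_radical (x : PGLtype n F) : (x \in radical) = (repr x \in 'Z(preGL)).
Proof.
have nZ (A : {set {'GL_n[F]}}) : A \subset 'N(Z).
  by apply/subsetP => g _; apply: center_GL_norm.
have E : coset Z @*^-1 radical = 'Z(preGL).
  by apply: quotientGK; rewrite /normal center_sub_preGL nZ.
by rewrite -E mem_cosetpre_GL coset_reprK.
Qed.

Lemma radicalP (x : PGLtype n F) : reflect (x \in L /\ {in L, forall y, lift x * lift y = lift y * lift x}%R)
  (x \in radical).
Proof.
rewrite mem_radical; apply: (iffP (centerP _ _)) => -[xL xC]; split.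
- by rewrite -repr_preGL.
- by move=> y yL; rewrite /lift -!GLvalM xC // repr_preGL.
- by rewrite repr_preGL.
move=> g; rewrite mem_preGL => gL; apply: GLval_inj; rewrite !GLvalM.
have [c c0 ->] := lift_coset g; rewrite -scalerAr -scalerAl; congr (_ *: _)%R.
exact: xC.
Qed.

Lemma norm_radical : 'N(L) \subset 'N(radical).
Proof.
apply/subsetP => x xN; rewrite -(coset_reprK x).
have: repr x \in 'N('Z(preGL)).
  apply: (subsetP (gFnorms _ _)); apply: (subsetP (morphpre_norm _ _)).
  by rewrite mem_cosetpre_GL coset_reprK.
by move/(mem_quotient Z); apply: (subsetP (quotient_norms _ (subxx _))).
Qed.

Lemma radical_full_comm : L \subset radical ->
  {in L &, forall x y, lift x * lift y = lift y * lift x}%R.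
Proof. by move=> LR x y /(subsetP LR)/radicalP[_ xC] yL; apply: xC. Qed.

(** The quotient of [preGL] by its centre has order |L : radical|. If that is prime the quotient is
    cyclic, so [preGL] is abelian. *)
Lemma radical_full_prime_index : prime #|L : radical| -> L \subset radical.
Proof.
move=> pr; have: abelian preGL.
  apply: cyclic_center_factor_abelian; apply: prime_cyclic.
  rewrite card_quotient ?normal_norm ?center_normal //.
  rewrite -(index_quotient_eq (G := preGL) (H := 'Z('GL_n[F])) (K := 'Z(preGL))) ?preGL_quo ?center_sub //.
    exact: subset_trans (subsetIr _ _) center_sub_preGL.
  by apply/subsetP => g _; apply: center_GL_norm.
by move=> /center_idP ab; rewrite -{1}preGL_quo /radical /= ab.
Qed.
End Radical.

(** * Arithmetic consequences of the commutator pairing *)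

Section Necessity.
Local Open Scope ring_scope.
Variables (p m n : nat) (F : finFieldType) (L : {group PGLtype n F}).
Hypotheses (p_pr : prime p) (n_gt0 : (0 < n)%N) (pF : ~~ (p %| #|F|)%N).
Hypotheses (Lp : (p.-abelem L)%g) (oL : #|L| = (p ^ (2 * m))%N).

(** Otherwise 1 has additive order p, which divides |F| by Lagrange. *)
Lemma natr_prime_neq0 : p%:R != 0 :> F.
Proof.
apply: contra pF => p0; have o1 : (#[1%R : F]%g %| p)%N by rewrite order_dvdn.
have <- : #[1%R : F]%g = p.
  by apply/prime_nt_dvdP => //; rewrite order_eq1; apply: oner_neq0.
by rewrite -cardsT order_dvdG ?inE.
Qed.

(** A commutator scalar w other than 1 satisfies w^p = 1, because the p-th power of a lift is
    scalar; hence p divides the order |F| - 1 of the unit group. *)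
Lemma noncommuting_lift_card :
  ~ {in L &, forall x y, lift x * lift y = lift y * lift x} -> #|F| = 1 %[mod p].
Proof.
move=> ncomm.
have /existsP[x /existsP[y /and3P[xL yL cxy]]] :
    [exists x, exists y, [&& x \in L, y \in L & lift_comm x y != 1]].
  apply: contraT => /existsPn no; case: ncomm => x y xL yL.
  have xy : commute x y by apply: (centsP (abelem_abelian Lp)).
  rewrite (lift_commE xy); have /existsPn/(_ y) := no x.
  by rewrite xL yL /= negbK => /eqP ->; rewrite scale1r.
set w := lift_comm x y in cxy.
have xy : commute x y by apply: (centsP (abelem_abelian Lp)).
have xyE := lift_commE xy; rewrite -/w in xyE.
have wp : w ^+ p = 1.
  have xk k : lift x ^+ k * lift y = w ^+ k *: (lift y * lift x ^+ k).
    elim: k => [|k IH]; first by rewrite !expr0 mul1r mulr1 scale1r.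
    rewrite !exprSr -mulrA xyE -scalerAr [lift x ^+ k * (_ * _)]mulrA IH.
    by rewrite -scalerAl scalerA [w * _]mulrC -[_ * _ * lift x]mulrA.
  have [c c0 xpE] : exists2 c, c != 0 & lift x ^+ p = c%:M.
    have : coset 'Z('GL_n[F])%g (repr x ^+ p)%g = coset 'Z('GL_n[F])%g 1%g.
      rewrite morphX ?center_GL_norm // morph1 /= coset_reprK.
      by case/and3P: Lp => _ _ /exponentP; apply.
    case/eq_cosetP => c c0 E; exists c => //.
    have gX g k : GLval (g ^+ k)%g = GLval g ^+ k :> 'M[F]_n.-1.+1.
      by elim: k => // k IH; rewrite expgS exprS GLvalM IH.
    by rewrite /lift -gX E -[GLval 1%g]/(1%:M) scalemx1.
  have := xk p; rewrite xpE -![_ * _]/(_ *m _) scalar_mxC => E.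
  have cy : c%:M *m lift y != 0.
    rewrite mul_scalar_mx scaler_eq0 (negPf c0) /=; exact: GLval_neq0.
  apply/eqP; rewrite -subr_eq0; have /eqP: (w ^+ p - 1) *: (c%:M *m lift y) = 0.
    by rewrite scalerBl -E scale1r subrr.
  by rewrite scaler_eq0 (negPf cy) orbF.
have wU : w \is a GRing.unit.
  by rewrite unitfE; apply: contraTneq (oner_neq0 F) => w0; rewrite -wp w0 expr0n gtn_eqF ?prime_gt0 ?eqxx.
have [u uE] : exists u : {unit F}, val u = w by exists (Sub w wU); apply: SubK.
have ou : #[u]%g = p.
  apply/prime_nt_dvdP => //; last first.
    by rewrite order_dvdn -val_eqE FinRing.val_unitX uE wp; apply: eqxx.
  by rewrite order_eq1 -val_eqE uE.
have : (p %| #|F|.-1)%N.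
  by rewrite -ou -card_finField_unit order_dvdG ?inE.
rewrite -subn1 -eqn_mod_dvd; first by move/eqP.
by apply/card_gt0P; exists 0.
Qed.

(** A trivial radical makes [lift_comm] nondegenerate on L, so the decomposition of the matrix
    algebra gives p^(2m) | n^2. *)
Lemma trivial_radical_dvdn : radical L :=: 1%g -> (p ^ m %| n)%N.
Proof.
move=> R1; have comm x y : x \in L -> y \in L -> commute x y.
  by move=> xL yL; apply: (centsP (abelem_abelian Lp)).
have : (#|L| %| n.-1.+1 ^ 2)%N.
  apply: (@card_dvdn_sqr_dim F _ L n.-1 (@lift n F) (@lift_comm n F)) => //.
  - by move=> x _; apply: lift_unit.
  - by move=> x y _ _; have [c _ ->] := lift_mul x y; exists c.
  - by move=> x y xL yL; apply: lift_commE; apply: comm.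
  - move=> x xL X1; have: x \in radical L.
      apply/radicalP; split=> // y yL.
      by rewrite (lift_commE (comm y x yL xL)) X1 // scale1r.
    by rewrite R1 inE => /eqP.
  by rewrite oL natrX expf_neq0 // natr_prime_neq0.
by rewrite oL prednK // mulnC expnM dvdn_pexp2r.
Qed.
End Necessity.

Lemma necessity (p m : nat) (F : finFieldType) (n : nat)
    (K : closedFieldType) (f : {rmorphism F -> K}) (L : {group PGLtype n F}) :
  prime p -> odd p -> (0 < m)%N -> ~~ (p %| #|F|)%N -> (0 < n)%N ->
  (p.-abelem L)%g -> #|L| = (p ^ (2 * m))%N -> ~ toral_in f L ->
  ('N_(PGL n F)(L) / 'C_(PGL n F)(L) \isog Sp m p)%g ->
  (p ^ m %| n)%N /\ #|F| = 1 %[mod p].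
Proof.
move=> p_pr p_odd m_gt0 pF n_gt0 Lp oL ntoral isoSp.
have ncomm : ~ {in L &, forall x y, lift x * lift y = lift y * lift x}%R.
  move=> comm; apply: ntoral; apply: (toral_of_commuting f _ _ comm (p := p)).
    exact: natr_prime_neq0.
  by case/and3P: Lp => _ _ /exponentP.
have nLR : ~ L \subset radical L by move=> LR; apply: ncomm (radical_full_comm LR).
split; last exact: noncommuting_lift_card p_pr Lp ncomm.
apply: (trivial_radical_dvdn p_pr n_gt0 pF Lp oL).
have p_gt1 := prime_gt1 p_pr.
(* The primitive prime divisor requires 2m > 2. For m = 1 the radical has order 1, p or p^2, and the
   last two cases would make it all of L. *)
case: m m_gt0 oL isoSp => // -[|m] _ oL isoSp.
  have /(dvdn_pfactor _ _ p_pr)[r r_le oR] : (#|radical L| %| p ^ (2 * 1))%N.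
    by rewrite -oL cardSg // radical_sub.
  case: r r_le oR => [|[|[|//]]] _ oR; first by apply: card1_trivg; rewrite oR.
    case: nLR; apply: radical_full_prime_index.
    by rewrite -divgS ?radical_sub // oL oR expn1 mulnK ?prime_gt0.
  case: nLR; have /eqP -> : (radical L : {set _}) == L; last exact: subxx.
  by rewrite eqEcard radical_sub oL oR muln1 leqnn.
have p_gt2 : (2 < p)%N by rewrite ltn_neqAle p_gt1 andbT; apply: contraTneq p_odd => <-.
have N_gt2 : (2 < 2 * m.+2)%N by rewrite !mulnS.
have [l [l_pr lp prim]] := exists_primitive_prime_divisor p_gt2 N_gt2.
have cE : 'C_('N_(PGL n F)(L))(L)%g = 'C_(PGL n F)(L)%g.
  by rewrite -setIA (setIidPr (cent_sub L)).
have lG : (l %| #|('N_(PGL n F)(L) / 'C_('N_(PGL n F)(L))(L))%g|)%N.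
  rewrite cE (card_isog isoSp) (dvdn_trans lp) //.
  exact: dvdn_card_Sp p_pr (ltn0Sn _).
have nR : 'N_(PGL n F)(L)%g \subset 'N(radical L)%g.
  by rewrite (subset_trans (subsetIr _ _)) ?norm_radical.
have [//|RL] := primitive_prime_irreducible p_pr l_pr oL (radical_sub L)
  (subsetIr _ _) nR prim (ltnW (ltnW N_gt2)) lp lG.
by case: nLR; rewrite RL.
Qed.

(** * Weyl systems *)

Section AdditiveCharacter.
Local Open Scope ring_scope.
Variables (p : nat) (F : finFieldType).
Hypothesis p_pr : prime p.

Lemma exists_root_of_unity : #|F| = 1 %[mod p] -> exists2 w : F, w ^+ p = 1 & w != 1.
Proof.
move=> /eqP F1; have F_gt0 : (0 < #|F|)%N by apply/card_gt0P; exists 0.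
have pF : (p %| #|[set: {unit F}]|)%N.
  by rewrite card_finField_unit -subn1 -eqn_mod_dvd.
have [u _ ou] := Cauchy p_pr pF; exists (val u).
  by rewrite -FinRing.val_unitX -ou expg_order.
apply/eqP => u1; have: #[u]%g = 1%N by apply/eqP; rewrite order_eq1 -val_eqE; apply/eqP.
by rewrite ou => p1; move: p_pr; rewrite p1.
Qed.

Variable w : F.
Hypotheses (wp : w ^+ p = 1) (w1 : w != 1).

(** An additive character of F_p: the exponent is the representative of a below p, so additivity
    rests on w^p = 1. *)
Definition eps (a : 'F_p) : F := w ^+ a.

Lemma epsD a b : eps (a + b) = eps a * eps b.
Proof.
rewrite /eps -exprD; have -> : (a + b)%R = ((a + b) %% p)%N :> nat.
  by rewrite /=; congr (_ %% _)%N; apply: Fp_cast.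
by rewrite [in RHS](divn_eq (a + b) p) exprD mulnC exprM wp expr1n mul1r.
Qed.

Lemma eps0 : eps 0 = 1.
Proof. by []. Qed.

Lemma eps_neq0 a : eps a != 0.
Proof.
by apply: contraTneq (oner_neq0 F) => ea; rewrite -eps0 -(subrr a) epsD ea mul0r eqxx.
Qed.

(** For nonzero a, Bezout makes w itself a power of w^a. *)
Lemma eps_eq1 a : eps a = 1 -> a = 0.
Proof.
move=> ea; apply/eqP; apply: contraNT w1 => a0.
have a_gt0 : (0 < a)%N by rewrite lt0n.
have a_ltp : (a < p)%N by rewrite -[X in (_ < X)%N](Fp_cast p_pr).
have [k l kl _] := egcdnP p a_gt0.
have /eqP g1 : gcdn a p == 1%N.
  by rewrite -[_ == _]/(coprime a p) coprime_sym prime_coprime // gtnNdvd.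
have : w ^+ (k * a) = 1 by rewrite mulnC exprM -/(eps a) ea expr1n.
by rewrite kl g1 exprD mulnC exprM wp expr1n mul1r expr1 => ->.
Qed.
End AdditiveCharacter.

Section WeylSystem.
Local Open Scope ring_scope.
Variables (p m n : nat) (F : finFieldType) (w : F).
Hypotheses (p_pr : prime p) (p_odd : odd p) (m_gt0 : (0 < m)%N) (wp : w ^+ p = 1) (w1 : w != 1).
Hypothesis p_neq0 : p%:R != 0 :> F.
Local Notation V := 'cV['F_p]_((2 * m).-1.+1).
Local Notation e := (eps w).
Variable W : V -> 'M[F]_n.+1.
Hypothesis W0 : W 0 = 1.
Hypothesis WM : forall u v, W u * W v = e (spform u v) *: W (u + v).

(** V is taken as an additive finite group, so in group notation the product is x + y and the unit
    is 0. *)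
Let A : {group V} := [set: V]%G.
Let X (u v : V) : F := e (spform u v *+ 2).

Let spA := spform_alt p_pr m_gt0.
Let spN := spformN p_pr m_gt0.

Lemma Weyl_mulV u : W u * W (- u) = 1.
Proof.
by rewrite WM subrr W0 -scaleN1r spformZr spA mulr0 eps0 scale1r.
Qed.

Lemma Weyl_unit u : W u \is a GRing.unit.
Proof.
apply/unitrP; exists (W (- u)); split; last exact: Weyl_mulV.
by rewrite -{2}(opprK u) Weyl_mulV.
Qed.

Lemma Weyl_comm u v : W u * W v = e (spform u v *+ 2) *: (W v * W u).
Proof.
rewrite !WM [v + u]addrC scalerA -epsD //; congr (e _ *: _).
by rewrite mulr2n (spN u v) addrK.
Qed.

(** Swapping two Weyl matrices costs twice the form; for odd p, doubling loses nothing. *)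
Lemma double_eq0 (a : 'F_p) : a *+ 2 = 0 -> a = 0.
Proof.
move/eqP; rewrite -mulr_natr mulf_eq0 => /orP[/eqP -> // | ].
rewrite -(dvdn_pcharf (pchar_Fp p_pr)) => p2.
have p2' : p = 2%N by apply/eqP; rewrite -(dvdn_prime2 p_pr).
by have := p_odd; rewrite [p in odd p]p2'.
Qed.

Lemma Weyl_nondeg (u : V) : (forall v, e (spform v u *+ 2) = 1) -> u = 0.
Proof.
move=> u1; apply/eqP/negPn/negP => /(spform_nondeg p_pr m_gt0)[v].
rewrite spN oppr_eq0 => /negP[]; apply/eqP/double_eq0.
exact: (eps_eq1 p_pr wp w1 (u1 v)).
Qed.

Lemma card_symplectic_space : #|A| = (p ^ (2 * m))%N.
Proof. by rewrite cardsT card_mx card_Fp // muln1 prednK // muln_gt0. Qed.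

Let WA_unit : {in A, forall x, W x \is a GRing.unit}.
Proof. by move=> x _; apply: Weyl_unit. Qed.
Let WA_mul : {in A &, forall x y, exists c, W x * W y = c *: W (x * y)%g}.
Proof. by move=> x y _ _; exists (e (spform x y)); rewrite WM. Qed.
Let WA_comm : {in A &, forall x y, W x * W y = X x y *: (W y * W x)}.
Proof. by move=> x y _ _; apply: Weyl_comm. Qed.
Let XA_nondeg : {in A, forall x, {in A, forall y, X y x = 1} -> x = 1%g}.
Proof. by move=> x _ X1; apply: Weyl_nondeg => v; apply: X1; rewrite inE. Qed.
Let cardA_neq0 : #|A|%:R != 0 :> F.
Proof. by rewrite card_symplectic_space natrX expf_neq0. Qed.

Lemma Weyl_commutant_decomposition h (psi : V -> F) : h != 0 ->
  (forall v, W v * h = psi v *: (h * W v)) ->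
  exists v d, (forall u, W u * d = d * W u) /\ h = W v * d.
Proof.
move=> h0 hW.
have [|v [d [_ dC ->]]] := normalizer_decomposition WA_unit WA_mul WA_comm XA_nondeg cardA_neq0 h0 (psi := psi).
  by move=> v _; apply: hW.
by exists v, d; split=> // u; apply: dC; rewrite inE.
Qed.

Hypothesis dimW : (p ^ (2 * m))%N = (n.+1 ^ 2)%N.

(** When p^(2m) is the square of the matrix size the commutant consists of scalars, and the
    decomposition becomes a linear combination of the W_v. *)
Lemma Weyl_span M : exists c : V -> F, M = \sum_v c v *: W v.
Proof.
have [d dC ->] := commutant_decomposition WA_unit WA_mul WA_comm XA_nondeg cardA_neq0 M.
have dS v : exists c, d v = c%:M.
  apply: (commutant_scalar WA_unit WA_mul WA_comm XA_nondeg cardA_neq0).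
    by rewrite card_symplectic_space.
  by apply: dC; rewrite inE.
have [c cE] := fin_all_exists dS; exists c.
rewrite (eq_bigl xpredT) => [|v]; last by rewrite inE.
by apply: eq_bigr => v _; rewrite cE; apply: mul_mx_scalar.
Qed.

Lemma Weyl_free (c : V -> F) : \sum_v c v *: W v = 0 -> forall v, c v = 0.
Proof.
move=> sum0 v.
have : (c v)%:M = 0 :> 'M[F]_n.+1.
  apply: (commutant_sum_eq0 WA_unit WA_mul WA_comm XA_nondeg cardA_neq0
    (d := fun v => (c v)%:M)) (in_setT v) => [x _ y _|].
    exact: scalar_mxC.
  rewrite -[RHS]sum0 (eq_bigl xpredT) => [|x]; last by rewrite inE.
  by apply: eq_bigr => x _; apply: mul_mx_scalar.
by move/matrixP/(_ 0 0); rewrite !mxE eqxx mulr1n.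
Qed.

(* The average P of W (S v) B W (- v) over v intertwines; it is nonzero for some elementary B by linear independence of the W v, and its row kernel is stable under the W v, which span the matrix algebra. *)
Lemma Weyl_intertwiner (S : 'M['F_p]_((2 * m).-1.+1)) :
  (forall u v, spform (S *m u) (S *m v) = spform u v) ->
  exists2 P : 'M[F]_n.+1, P \is a GRing.unit & forall v, P * W v = W (S *m v) * P.
Proof.
move=> Ssp; pose Pi (B : 'M[F]_n.+1) := \sum_v W (S *m v) * B * W (- v).
have PiW B v : Pi B * W v = W (S *m v) * Pi B.
  rewrite /Pi mulr_suml mulr_sumr (reindex_inj (addrI v)) /=.
  apply: eq_bigr => u _; rewrite -mulrA WM !mulrA WM -scalerAr -!scalerAl Ssp -mulmxDr.
  congr (e _ *: (_ * W _)); last by rewrite opprD addrAC addNr add0r.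
  by rewrite -scaleN1r spformZl spformDl spA add0r mulN1r spN opprK.
have [i [j Pij]] : exists i j, Pi (delta_mx i j) != 0.
  case: (boolP [exists i, exists j, Pi (delta_mx i j) != 0]).
    by move=> /existsP[i /existsP[j ij]]; exists i, j.
  move=> /existsPn no; have Pi0 i j : Pi (delta_mx i j) = 0.
    by have /existsPn/(_ j) := no i; rewrite negbK => /eqP.
  (* Entry (0, b) of the average of E_0j is entry (j, b) of this combination, after v |-> -v. Its
     coefficient at v = 0 is 1, which contradicts independence. *)
  have sum0 : \sum_v W (S *m (- v)) 0 0 *: W v = 0.
    apply/matrixP => j b; have /= E := congr1 (fun M : 'M_n.+1 => M 0 b) (Pi0 0 j).
    rewrite [RHS]mxE in E; rewrite [RHS]mxE -[RHS]E /Pi !summxE (reindex_inj oppr_inj) /=.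
    apply: eq_bigr => v _; rewrite opprK !mxE (bigD1 j) //=.
    rewrite big1 ?addr0 => [|k kj].
      rewrite !mxE (bigD1 0) //= big1 ?addr0 => [|k k0].
        by rewrite !mxE !eqxx mulr1.
      by rewrite !mxE (negPf k0) mulr0.
    rewrite mxE big1 ?mul0r // => l _; rewrite mxE (negPf kj) andbF mulr0 //.
  have := Weyl_free sum0 0; rewrite oppr0 mulmx0 W0 mxE eqxx => /eqP.
  by rewrite oner_eq0.
set P := Pi _ in Pij; exists P; last exact: PiW.
have SU := spform_preserving_unitmx p_pr m_gt0 Ssp.
rewrite -[_ \is a _]/(P \in unitmx) -row_free_unit; apply/inj_row_free => u uP.
have uMP M : u *m M *m P = 0.
  have [c ->] := Weyl_span M; rewrite -mulmxA mulmx_suml mulmx_sumr big1 // => v _.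
  have := PiW (delta_mx i j) (invmx S *m v); rewrite -/P mulKVmx // => PW.
  rewrite -scalemxAl -scalemxAr -[W v *m P]PW mulmxA uP mul0mx.
  exact: scaler0.
apply/eqP; apply: contraNT Pij => /rV0Pn[a ua]; apply/eqP/row_matrixP => b.
rewrite row0 rowE; have -> : delta_mx 0 b = u *m ((u 0 a)^-1 *: delta_mx a b).
  rewrite -scalemxAr; apply/rowP => l; rewrite !mxE (bigD1 a) //= big1 ?addr0 => [|k ka].
    by rewrite !mxE !eqxx /= mulrA mulVf // mul1r.
  by rewrite mxE (negPf ka) mulr0.
exact: uMP.
Qed.
End WeylSystem.

(** * Kronecker products *)

Section Kronecker.
Local Open Scope ring_scope.
Variables (F : fieldType) (a b N : nat) (phi : 'I_N -> 'I_a.+1 * 'I_b.+1).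
Hypothesis phi_bij : bijective phi.

(** Relabelling indices by [phi] gives the product the size N itself, so it can live in the matrix
    type underlying GL_n. *)
Definition kron (A : 'M[F]_a.+1) (B : 'M[F]_b.+1) : 'M[F]_N :=
  \matrix_(i, j) (A (phi i).1 (phi j).1 * B (phi i).2 (phi j).2).

Lemma kronM A B C D : kron A B *m kron C D = kron (A *m C) (B *m D).
Proof.
apply/matrixP => i l; rewrite !mxE big_distrlr pair_bigA /=.
rewrite [RHS](reindex phi) /=; last exact: onW_bij.
by apply: eq_bigr => j _; rewrite !mxE mulrACA.
Qed.

Lemma kron1 : kron 1%:M 1%:M = 1%:M.
Proof.
apply/matrixP => i j; rewrite !mxE -natrM mulnb; congr (_%:R).
rewrite -(bij_eq phi_bij); case: (phi i) (phi j) => [i1 i2] [j1 j2].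
by rewrite -pair_eqE.
Qed.

Lemma kronZl c A B : kron (c *: A) B = c *: kron A B.
Proof. by apply/matrixP => i j; rewrite !mxE mulrA. Qed.

Lemma kronZr c A B : kron A (c *: B) = c *: kron A B.
Proof. by apply/matrixP => i j; rewrite !mxE mulrCA. Qed.

Lemma kron_suml (I : finType) (A : I -> 'M[F]_a.+1) B :
  kron (\sum_i A i) B = \sum_i kron (A i) B.
Proof.
apply/matrixP => i j; rewrite !mxE !summxE mulr_suml.
by apply: eq_bigr => k _; rewrite mxE.
Qed.

Lemma kron1_inj : injective (kron 1%:M).
Proof.
have [phi' _ phi'K] := phi_bij.
move=> B C /matrixP BC; apply/matrixP => i j.
have := BC (phi' (0, i)) (phi' (0, j)).
by rewrite !mxE !phi'K /= !mul1r.
Qed.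

(** Commuting with every E_xy (x) 1 kills the off-diagonal blocks of M and makes the diagonal ones
    equal; the witness is the block at (0, 0). *)
Lemma kron_commutant (M : 'M[F]_N) :
  (forall A, kron A 1%:M *m M = M *m kron A 1%:M) -> exists B, M = kron 1%:M B.
Proof.
have [phi' phiK phi'K] := phi_bij.
move=> MC; exists (\matrix_(i, j) M (phi' (0, i)) (phi' (0, j))).
have entryl (x y z : 'I_a.+1) t (j : 'I_N) :
    (kron (delta_mx x y) 1%:M *m M) (phi' (z, t)) j = M (phi' (y, t)) j *+ (z == x).
  rewrite mxE (bigD1 (phi' (y, t))) //= big1 ?addr0 => [|l ly].
    by rewrite !mxE !phi'K /= !eqxx andbT mulr1 mulr_natl.
  rewrite !mxE phi'K /=; have [/andP[_ /eqP E1]|_] := boolP ((z == x) && _); last by rewrite !mul0r.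
  have [E2|_] := eqVneq t (phi l).2; last by rewrite mulr0 mul0r.
  by case/eqP: ly; rewrite -[l]phiK E2 -E1; case: (phi l).
have entryr (x y z : 'I_a.+1) t (j : 'I_N) :
    (M *m kron (delta_mx x y) 1%:M) j (phi' (z, t)) = M j (phi' (x, t)) *+ (z == y).
  rewrite mxE (bigD1 (phi' (x, t))) //= big1 ?addr0 => [|l lx].
    by rewrite !mxE !phi'K /= !eqxx mulr1 mulr_natr.
  rewrite !mxE phi'K /=; have [/andP[/eqP E1 _]|_] := boolP (_ && (z == y)); last by rewrite mul0r mulr0.
  have [E2|_] := eqVneq (phi l).2 t; last by rewrite !mulr0.
  by case/eqP: lx; rewrite -[l]phiK -E2 -E1; case: (phi l).
have ME x y (z z' : 'I_a.+1) t t' :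
    M (phi' (y, t)) (phi' (z', t')) *+ (z == x) = M (phi' (z, t)) (phi' (x, t')) *+ (z' == y).
  by rewrite -entryl -entryr MC.
apply/matrixP => i j; rewrite !mxE -{1}[i]phiK -{1}[j]phiK.
case: (phi i) (phi j) => [x t] [y s] /=.
have := ME 0 x 0 y t s; rewrite eqxx mulr1n => ->.
by rewrite eq_sym mulr_natl.
Qed.
End Kronecker.

Lemma exists_ord_pair_bij N a b : N = (a * b)%N ->
  exists phi : 'I_N -> 'I_a * 'I_b, bijective phi.
Proof.
move=> NE; have cE : N = #|{: 'I_a * 'I_b}| by rewrite card_prod !card_ord.
exists (fun i => enum_val (cast_ord cE i)).
apply: bij_comp; first exact: enum_val_bij.
exists (cast_ord (esym cE)); [exact: cast_ordK | exact: cast_ordKV].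
Qed.

(** * Heisenberg-Weyl matrices *)

Section Heisenberg.
Local Open Scope ring_scope.
Variables (p m a : nat) (F : finFieldType) (w : F) (psi : 'I_a.+1 -> 'rV['F_p]_m).
Hypotheses (p_pr : prime p) (m_gt0 : (0 < m)%N) (wp : w ^+ p = 1).
Hypothesis psi_bij : bijective psi.
Local Notation V := 'cV['F_p]_((2 * m).-1.+1).

Definition dot (x y : 'rV['F_p]_m) : 'F_p := \sum_i x 0 i * y 0 i.

Lemma dotC x y : dot x y = dot y x.
Proof. by apply: eq_bigr => i _; rewrite mulrC. Qed.

Lemma dotDr x y z : dot x (y + z) = dot x y + dot x z.
Proof. by rewrite -big_split; apply: eq_bigr => i _; rewrite mxE mulrDr. Qed.

Lemma dotDl x y z : dot (x + y) z = dot x z + dot y z.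
Proof. by rewrite dotC dotDr !(dotC z). Qed.

(** Position and momentum halves of a vector, as rows because [psi] labels the basis states by
    rows. *)
Definition pos (v : V) : 'rV['F_p]_m := \row_i v (lo i) 0.
Definition mom (v : V) : 'rV['F_p]_m := \row_i v (hi i) 0.

Lemma spform_dot u v : spform u v = dot (pos u) (mom v) - dot (mom u) (pos v).
Proof.
rewrite spformE // sumrB; congr (_ - _); by apply: eq_bigr => i _; rewrite !mxE.
Qed.

(* (heis v f)(x) = w ^ (2 b.x + a.b) f(x + a) for v = (a, b): the phase a.b makes the cocycle [w ^ spform], which depends only on the symplectic form. *)
Definition heis (v : V) : 'M[F]_a.+1 := \matrix_(i, j)
  (eps w (dot (mom v) (psi i) *+ 2 + dot (pos v) (mom v)) *+ (psi j == psi i + pos v)).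

Lemma heisM u v : heis u * heis v = eps w (spform u v) *: heis (u + v).
Proof.
have [psi' psiK psi'K] := psi_bij.
apply/matrixP => i l; rewrite !mxE (bigD1 (psi' (psi i + pos u))) //=.
rewrite big1 ?addr0 => [|j ji]; last first.
  rewrite !mxE; case: eqP => [E | _]; last by rewrite mulr0n mul0r.
  by case/eqP: ji; rewrite -E psiK.
rewrite !mxE psi'K eqxx mulr1n mulrnAr -epsD // mulrnAr -epsD //.
have -> : pos (u + v) = pos u + pos v by apply/rowP => k; rewrite !mxE.
have -> : mom (u + v) = mom u + mom v by apply/rowP => k; rewrite !mxE.
rewrite [psi i + (_ + _)]addrA; congr (eps w _ *+ _).
rewrite spform_dot !(dotDl, dotDr) (dotC (pos u) (mom v)) (dotC (pos v) (mom u)).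
by ring.
Qed.

Lemma heis0 : heis 0 = 1.
Proof.
apply/matrixP => i j; rewrite !mxE.
have -> : pos 0 = 0 by apply/rowP => k; rewrite !mxE.
have -> : mom 0 = 0 by apply/rowP => k; rewrite !mxE.
have dot0 x : dot 0 x = 0 by rewrite /dot big1 // => k _; rewrite mxE mul0r.
by rewrite !dot0 mul0rn addr0 eps0 addr0 (bij_eq psi_bij) eq_sym.
Qed.
End Heisenberg.

(** * The subgroup attached to a Weyl system *)

Section Sufficiency.
Local Open Scope ring_scope.
Variables (p m n k : nat) (F : finFieldType) (w : F).
Hypotheses (p_pr : prime p) (p_odd : odd p) (m_gt0 : (0 < m)%N).
Hypotheses (wp : w ^+ p = 1) (w1 : w != 1) (p_neq0 : p%:R != 0 :> F).
Local Notation V := 'cV['F_p]_((2 * m).-1.+1).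
Local Notation Z := ('Z('GL_n[F]))%g.
(** [W] stands for the Weyl matrices tensored with an identity, and [iota] for B |-> 1 (x) B; the
    group theory below uses only the properties listed. *)
Variables (W : V -> 'M[F]_n.-1.+1) (iota : 'M[F]_k.-1.+1 -> 'M[F]_n.-1.+1).
Hypothesis W0 : W 0 = 1.
Hypothesis WM : forall u v, W u * W v = eps w (spform u v) *: W (u + v).
Hypothesis iotaM : forall B C, iota B * iota C = iota (B * C).
Hypothesis iota1 : iota 1 = 1.
Hypothesis iotaZ : forall c B, iota (c *: B) = c *: iota B.
Hypothesis iota_inj : injective iota.
Hypothesis W_iota : forall v B, W v * iota B = iota B * W v.
Hypothesis commutant_iota : forall d, (forall v, W v * d = d * W v) -> exists B, d = iota B.
Hypothesis intertwiner : forall S : 'M['F_p]_((2 * m).-1.+1),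
  (forall u v, spform (S *m u) (S *m v) = spform u v) ->
  exists2 P : 'M[F]_n.-1.+1, P \is a GRing.unit & forall v, P * W v = W (S *m v) * P.

Variable gW : V -> {'GL_n[F]}.
Hypothesis gWE : forall v, GLval (gW v) = W v.
Variable gI : {'GL_k[F]} -> {'GL_n[F]}.
Hypothesis gIE : forall B, GLval (gI B) = iota (GLval B).

Definition lam (v : V) : PGLtype n F := coset Z (gW v).

Lemma coset_commute_scalar (g : {'GL_n[F]}) v : commute (coset Z g) (lam v) ->
  exists c, W v * GLval g = c *: (GLval g * W v).
Proof.
move=> /esym; rewrite /commute -!coset_morphM ?center_GL_norm // => /eq_cosetP[c _].
by rewrite !GLvalM gWE => E; exists c.
Qed.

Lemma lamD u v : lam (u + v) = (lam u * lam v)%g.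
Proof.
rewrite -coset_morphM ?center_GL_norm //; apply/esym/eq_cosetP.
by exists (eps w (spform u v)); rewrite ?eps_neq0 // GLvalM !gWE WM.
Qed.

Lemma lam0 : lam 0 = 1%g.
Proof. by apply: (mulgI (lam 0)); rewrite -lamD addr0 mulg1. Qed.

Lemma lamN v : lam (- v) = (lam v)^-1%g.
Proof. by apply: (mulgI (lam v)); rewrite -lamD subrr mulgV lam0. Qed.

Lemma Weyl_commute_eq0 v : (forall u, W u * W v = W v * W u) -> v = 0.
Proof.
move=> vC; apply: (Weyl_nondeg p_pr p_odd m_gt0 wp w1) => u.
have U x := Weyl_unit p_pr m_gt0 W0 WM x.
have WW0 : W v * W u != 0.
  have : W v * W u \is a GRing.unit by rewrite unitrMl.
  by apply: contraTneq => ->; rewrite unitr0.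
have /eqP := vC u; rewrite (Weyl_comm p_pr m_gt0 wp WM) -subr_eq0.
rewrite -{2}[W v * W u]scale1r -scalerBl scaler_eq0 (negPf WW0) orbF subr_eq0.
by move/eqP.
Qed.

(** The image of [iota] commutes with every W_u, so nondegeneracy leaves v = 0. This yields both the
    injectivity of [lam] and the trivial intersection in the centraliser. *)
Lemma lam_eq_iota v B : lam v = coset Z (gI B) -> v = 0.
Proof.
case/eq_cosetP => c c0; rewrite gWE gIE => E.
by apply: Weyl_commute_eq0 => u; rewrite E -scalerAr -scalerAl W_iota.
Qed.

Lemma lam_inj : injective lam.
Proof.
move=> u v uv; apply/eqP; rewrite -subr_eq0; apply/eqP.
apply: (@lam_eq_iota _ 1%g); rewrite lamD lamN uv mulgV.
have -> : gI 1%g = 1%g by apply: GLval_inj; rewrite gIE iota1.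
by rewrite morph1.
Qed.

Lemma lam_morph : {in [set: V] &, {morph lam : u v / (u * v)%g}}.
Proof. by move=> u v _ _; apply: lamD. Qed.
Definition lam_morphism := Morphism lam_morph.

Definition Lam : {group PGLtype n F} := (lam_morphism @* [set: V])%G.

Lemma LamP x : reflect (exists v, x = lam v) (x \in Lam).
Proof.
apply: (iffP morphimP) => [[v _ _ ->]|[v ->]]; first by exists v.
by exists v; rewrite ?inE.
Qed.

Lemma Lam_card : #|Lam| = (p ^ (2 * m))%N.
Proof.
rewrite card_injm ?subsetT //; first exact: card_symplectic_space.
by apply/injmP => u v _ _; apply: lam_inj.
Qed.

Lemma Lam_abelem : (p.-abelem Lam)%g.
Proof.
rewrite abelemE //; apply/andP; split.
  by apply/centsP => _ /LamP[u ->] _ /LamP[v ->]; rewrite /commute -!lamD addrC.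
apply/exponentP => _ /LamP[v ->].
have lamX i : (lam v ^+ i)%g = lam (v *+ i).
  by elim: i => [|i IH]; rewrite ?lam0 // expgS IH -lamD mulrS.
by rewrite lamX -scaler_nat (pcharf0 (pchar_Fp p_pr)) scale0r lam0.
Qed.

(** A common diagonalization over K would make all W_u commute, already over F as f is injective;
    then every v would be 0. *)
Lemma Lam_nontoral (K : fieldType) (f : {rmorphism F -> K}) : ~ toral_in f Lam.
Proof.
move=> [P PU Pdiag].
have comm u v : W u * W v = W v * W u.
  have D x := Pdiag (gW x) (introT (LamP _) (ex_intro _ x erefl)).
  rewrite -![_ * _]/(_ *m _); apply: (@map_mx_inj _ _ f); rewrite !map_mxM /=.
  have := D u; have := D v; rewrite !gWE.
  set A := map_mx f (W u); set B := map_mx f (W v).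
  move=> /diag_mxP[dB BE] /diag_mxP[dA AE].
  have AB : (invmx P *m A *m P) *m (invmx P *m B *m P) = (invmx P *m B *m P) *m (invmx P *m A *m P).
    by rewrite AE BE diag_mxC.
  have conjM X Y : (invmx P *m X *m P) *m (invmx P *m Y *m P) = invmx P *m (X *m Y) *m P.
    by rewrite !mulmxA mulmxK.
  have := congr1 (fun M => P *m M *m invmx P) AB.
  by rewrite /= !conjM !mulmxA mulmxV // !mul1mx !mulmxK.
have : (const_mx 1 : V) = 0 by apply: Weyl_commute_eq0.
by move/matrixP/(_ 0 0)/eqP; rewrite !mxE oner_eq0.
Qed.

Lemma kappa_morph : {in 'GL_k[F]%g &, {morph (fun B => coset Z (gI B)) : B C / (B * C)%g}}.
Proof.
move=> B C _ _; rewrite -coset_morphM ?center_GL_norm //; congr coset.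
by apply: GLval_inj; rewrite GLvalM !gIE iotaM.
Qed.
Definition kappa := Morphism kappa_morph.

Lemma ker_kappa : ('ker kappa)%g = 'Z('GL_k[F])%g.
Proof.
apply/setP => B; apply/idP/idP => [/kerP|].
  rewrite inE => /(_ isT) /= E.
  have : coset Z (gI B) = coset Z 1%g by rewrite E morph1.
  case/eq_cosetP => c c0; rewrite gIE -[GLval 1%g]/(1 : 'M_n.-1.+1) -iota1 -iotaZ => /iota_inj BE.
  apply/centerP; split=> [|C _]; first by rewrite inE.
  by apply: GLval_inj; rewrite !GLvalM BE -scalerAr -scalerAl mul1r mulr1.
case/mem_center_GL => c c0 BE; apply/kerP; rewrite ?inE //=.
suff -> : coset Z (gI B) = coset Z 1%g by rewrite morph1.
apply/eq_cosetP; exists c => //; rewrite gIE BE -scalemx1 iotaZ.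
by rewrite -[1%:M]/(1 : 'M_k.-1.+1) iota1.
Qed.

(** The inverse of [iota B] still commutes with the W_v, so it is some [iota C], and C inverts B. *)
Lemma iota_unit B : iota B \is a GRing.unit -> B \is a GRing.unit.
Proof.
move=> U; have [|C CE] := commutant_iota (d := (iota B)^-1).
  move=> v; apply: (mulrI U); apply: (mulIr U).
  by rewrite mulrA -W_iota -!mulrA mulVr // mulr1 mulrA mulrV // mul1r.
apply/unitrP; exists C; split; apply: iota_inj; rewrite -iotaM iota1 -CE.
  exact: mulVr.
exact: mulrV.
Qed.

(** A lift of a centralising element commutes with each W_v up to a scalar, hence equals some W_v d
    with d in the commutant, that is, in the image of [iota]. *)
Lemma cent_Lam : 'C_(PGL n F)(Lam)%g = (Lam * kappa @* 'GL_k[F])%g.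
Proof.
apply/setP => x; apply/idP/mulsgP.
  case/setIP => _ /centP xC; rewrite -(coset_reprK x); set g := repr x.
  have gC v : exists c, W v * GLval g = c *: (GLval g * W v).
    apply: coset_commute_scalar; rewrite coset_reprK; apply: xC.
    by apply/LamP; exists v.
  have [psi psiE] := fin_all_exists gC.
  have [v [d [dC gE]]] := Weyl_commutant_decomposition p_pr p_odd m_gt0 wp w1 p_neq0 W0 WM
    (GLval_neq0 g) psiE.
  have [B dE] := commutant_iota dC.
  have BU : B \is a GRing.unit.
    apply: iota_unit; rewrite -dE -(mulKr (Weyl_unit p_pr m_gt0 W0 WM v) d) -gE.
    by rewrite unitrMl ?GLval_unit // unitrV (Weyl_unit p_pr m_gt0 W0 WM).
  have [b bE] := exists_GL BU.
  exists (lam v) (kappa b).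
  - by apply/LamP; exists v.
  - by apply: mem_morphim; rewrite inE.
  rewrite /= -coset_morphM ?center_GL_norm //; congr coset.
  by apply: GLval_inj; rewrite GLvalM gWE gIE bE -dE gE.
case=> _ _ /LamP[v ->] /morphimP[b _ _ ->] ->.
rewrite inE mem_PGL groupM //.
  apply/centP => _ /LamP[u ->]; rewrite /commute -!lamD; congr lam; exact: addrC.
apply/centP => _ /LamP[u ->] /=; rewrite /commute -!coset_morphM ?center_GL_norm //.
by congr coset; apply: GLval_inj; rewrite !GLvalM gWE gIE W_iota.
Qed.

Lemma cent_Lam_isog : ('C_(PGL n F)(Lam) \isog setX Lam (PGL k F))%g.
Proof.
have isoQ : PGL k F \isog (kappa @* 'GL_k[F])%g.
  by rewrite /PGL /= -ker_kappa; apply: first_isog.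
have dp : (Lam \x (kappa @* 'GL_k[F]) = 'C_(PGL n F)(Lam))%g.
  rewrite dprodE -?cent_Lam //.
    apply: subset_trans (subsetIr (PGL n F) _); rewrite cent_Lam.
    exact: mulG_subr.
  apply/trivgP/subsetP => x /setIP[/LamP[v ->] /morphimP[b _ _ E]].
  by rewrite (lam_eq_iota E) lam0 inE.
apply: (isog_dprod dp (setX_dprod _ _)); first exact: isog_setX1.
by apply: isog_trans (isog_set1X _ _); rewrite isog_sym.
Qed.

(** Conjugation by x induces an additive, hence F_p-linear, map on V. It preserves commutators of
    the W_v, thus twice the form, thus the form. *)
Lemma norm_Lam_action x : x \in 'N_(PGL n F)(Lam)%g ->
  exists2 S : {'GL_(2 * m)['F_p]}, S \in Sp m p &
    forall v, lam (GLval S *m v) = (x * lam v * x^-1)%g.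
Proof.
case/setIP => _ xN.
have sig v : exists u, lam u = (x * lam v * x^-1)%g.
  have : (lam v ^ x^-1)%g \in Lam by rewrite memJ_norm ?groupV //; apply/LamP; exists v.
  by case/LamP => u E; exists u; rewrite -E conjgE invgK mulgA.
have [s sE] := fin_all_exists sig.
have sD u v : s (u + v) = s u + s v.
  by apply: lam_inj; rewrite lamD !sE lamD !mulgA mulgKV.
have s0 : s 0 = 0 by apply: lam_inj; rewrite sE lam0 mulg1 mulgV.
have sX v i : s (v *+ i) = s v *+ i.
  by elim: i => [|i IH]; rewrite ?mulr0n // !mulrS sD IH.
have sZ (c : 'F_p) v : s (c *: v) = c *: s v.
  by rewrite -[c]natr_Zp !scaler_nat sX.
have s_sum (I : finType) (G : I -> V) : s (\sum_i G i) = \sum_i s (G i).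
  exact: (big_morph s sD s0).
pose S : 'M['F_p]_((2 * m).-1.+1) := \matrix_(i, j) s (delta_mx j 0) i 0.
have SE v : S *m v = s v.
  rewrite [v in RHS](matrix_sum_delta v) s_sum.
  apply/colP => i; rewrite mxE summxE; apply: eq_bigr => j _.
  by rewrite big_ord1 sZ !mxE mulrC.
have Ssp u v : spform (S *m u) (S *m v) = spform u v.
  rewrite !SE.
  have conjW y : exists2 c, c != 0 & W (s y) * GLval (repr x) = c *: (GLval (repr x) * W y).
    have : coset Z (gW (s y) * repr x)%g = coset Z (repr x * gW y)%g.
      rewrite !coset_morphM ?center_GL_norm // coset_reprK.
      by rewrite -/(lam (s y)) sE mulgKV.
    by case/eq_cosetP => c c0; rewrite !GLvalM !gWE => E; exists c.
  have [c c0 cE] := conjW u; have [b b0 bE] := conjW v.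
  set h := GLval (repr x) in cE bE.
  have hU : h \is a GRing.unit by apply: GLval_unit.
  (* Both orders of the product acquire the same scalar b * c, so it cancels when the commutators
     are compared. *)
  have prodW y z c1 b1 : W (s y) * h = c1 *: (h * W y) -> W (s z) * h = b1 *: (h * W z) ->
      W (s y) * W (s z) * h = (b1 * c1) *: (h * (W y * W z)).
    move=> yE zE; rewrite -mulrA zE -scalerAr mulrA yE -scalerAl scalerA.
    by rewrite mulrA.
  have E := prodW _ _ _ _ cE bE; have E' := prodW _ _ _ _ bE cE.
  rewrite (Weyl_comm p_pr m_gt0 wp WM) -scalerAl E' in E.
  rewrite [W u * W v](Weyl_comm p_pr m_gt0 wp WM) -scalerAr !scalerA in E.
  have hW0 : h * (W v * W u) != 0.
    have U y := Weyl_unit p_pr m_gt0 W0 WM y.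
    have : h * (W v * W u) \is a GRing.unit by rewrite !unitrMl.
    by apply: contraTneq => ->; rewrite unitr0.
  move/eqP: E; rewrite -subr_eq0 -scalerBl scaler_eq0 (negPf hW0) orbF subr_eq0.
  rewrite [b * c]mulrC [_ * eps w _]mulrC => /eqP/(mulIf (mulf_neq0 c0 b0)) {}E.
  apply/eqP; rewrite -subr_eq0; apply/eqP/(double_eq0 p_pr p_odd).
  rewrite mulrnBl; apply: (eps_eq1 p_pr wp w1).
  by apply: (mulIf (eps_neq0 p_pr wp (spform u v *+ 2))); rewrite -epsD // subrK E mul1r.
have [g gE] := exists_GL (spform_preserving_unitmx p_pr m_gt0 Ssp : S \is a GRing.unit).
exists g; first by apply/Sp_spformP => u v; rewrite gE Ssp.
by move=> v; rewrite gE SE sE.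
Qed.

(** The class of an intertwiner of S conjugates [lam v] to the image of S v. *)
Lemma norm_Lam_surj (S : {'GL_(2 * m)['F_p]}) : S \in Sp m p ->
  exists2 x, x \in 'N_(PGL n F)(Lam)%g &
    forall v, lam (GLval S *m v) = (x * lam v * x^-1)%g.
Proof.
move=> /Sp_spformP Ssp; have [P PU PW] := intertwiner Ssp.
have [g gE] := exists_GL PU; pose x := coset Z g.
have xE v : lam (GLval S *m v) = (x * lam v * x^-1)%g.
  apply: (mulIg x); rewrite mulgKV /x -!coset_morphM ?center_GL_norm //; congr coset.
  by apply: GLval_inj; rewrite !GLvalM gE !gWE PW.
exists x => //; rewrite inE mem_PGL -groupV inE.
apply/subsetP => _ /imsetP[_ /LamP[v ->] ->]; apply/LamP; exists (GLval S *m v).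
by rewrite xE conjgE invgK mulgA.
Qed.

Lemma norm_Lam_isog : ('N_(PGL n F)(Lam) / 'C_(PGL n F)(Lam) \isog Sp m p)%g.
Proof.
set N := 'N_(PGL n F)(Lam)%g.
(* Off the normaliser the value is a default 1, so that a total function can be chosen. Conjugating
   on the left makes it multiplicative in x. *)
have ex x : exists S : {'GL_(2 * m)['F_p]}, x \in N -> S \in Sp m p /\
    forall v, lam (GLval S *m v) = (x * lam v * x^-1)%g.
  have [xN|_] := boolP (x \in N); last by exists 1%g.
  by have [S SSp SE] := norm_Lam_action xN; exists S.
have [act actE] := fin_all_exists ex.
have GL_eq (S T : {'GL_(2 * m)['F_p]}) :
    (forall v, lam (GLval S *m v) = lam (GLval T *m v)) -> S = T.
  move=> ST; apply: GLval_inj; apply/matrixP => i j.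
  have /lam_inj/colP/(_ i) := ST (delta_mx j 0).
  by rewrite -!colE !mxE.
have actM : {in N &, {morph act : x y / (x * y)%g}}.
  move=> x y xN yN; apply: GL_eq => v.
  have [_ ->] := actE _ (groupM xN yN).
  rewrite GLvalM -[_ * _ *m v]mulmxA; have [_ ->] := actE _ xN.
  by have [_ ->] := actE _ yN; rewrite invMg !mulgA.
pose rho := Morphism actM.
have im : (rho @* N = Sp m p)%g.
  apply/setP => S; apply/morphimP/idP => [[x xN _ ->]|SSp].
    by case: (actE x xN).
  have [x xN xE] := norm_Lam_surj SSp; exists x => //.
  by apply: GL_eq => v; rewrite xE; case: (actE x xN) => _ ->.
have ke : ('ker rho = 'C_(PGL n F)(Lam))%g.
  apply/setP => x; apply/idP/idP => [xk | xC].
    have xN := dom_ker xk; have /= x1 := mker xk.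
    rewrite inE mem_PGL; apply/centP => _ /LamP[v ->].
    have [_ /(_ v)] := actE x xN; rewrite x1 mul1mx => E.
    by rewrite /commute [in RHS]E mulgKV.
  have xN : x \in N.
    case/setIP: xC => xP xC; apply/setIP; split=> //.
    exact: (subsetP (cent_sub _)) _ xC.
  apply/kerP => //; apply: GL_eq => v /=; have [_ ->] := actE x xN.
  case/setIP: xC => _ /centP xC; rewrite xC ?mulgK ?mul1mx //.
  by apply/LamP; exists v.
by rewrite -ke -im; apply: first_isog.
Qed.
End Sufficiency.

(** * Existence from Heisenberg-Weyl matrices *)

Section Existence.
Local Open Scope ring_scope.

Lemma sufficiency (p m : nat) (F : finFieldType) (n : nat)
    (K : closedFieldType) (f : {rmorphism F -> K}) :
  prime p -> odd p -> (0 < m)%N -> ~~ (p %| #|F|)%N -> (0 < n)%N ->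
  (p ^ m %| n)%N -> (#|F| = 1 %[mod p])%N ->
  exists L : {group PGLtype n F},
    [/\ L \subset PGL n F, (p.-abelem L)%g, #|L| = (p ^ (2 * m))%N,
        ~ toral_in f L &
        (exists2 k : nat, (0 < k < n)%N &
           ('C_(PGL n F)(L) \isog setX L (PGL k F))%g)] /\
    ('N_(PGL n F)(L) / 'C_(PGL n F)(L) \isog Sp m p)%g.
Proof.
move=> p_pr p_odd m_gt0 pF n_gt0 /dvdnP[k nE] F1.
have p_neq0 := natr_prime_neq0 p_pr pF.
have [w wp w1] := exists_root_of_unity p_pr F1.
have k_gt0 : (0 < k)%N by move: n_gt0; rewrite nE muln_gt0 => /andP[].
have pm_gt0 : (0 < p ^ m)%N by rewrite expn_gt0 prime_gt0.
pose a := (p ^ m)%N.-1; pose b := k.-1.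
have aE : a.+1 = (p ^ m)%N by apply: prednK.
have bE : b.+1 = k by apply: prednK.
have NE : n.-1.+1 = (a.+1 * b.+1)%N by rewrite prednK // aE bE mulnC.
have [phi phi_bij] := exists_ord_pair_bij NE.
have [psi psi_bij] : exists psi : 'I_a.+1 -> 'rV['F_p]_m, bijective psi.
  have cE : a.+1 = #|{: 'rV['F_p]_m}| by rewrite card_mx card_Fp // mul1n.
  exists (fun i => enum_val (cast_ord cE i)).
  apply: bij_comp; first exact: enum_val_bij.
  by exists (cast_ord (esym cE)); [exact: cast_ordK | exact: cast_ordKV].
pose H := heis w psi.
have HM := heisM p_pr m_gt0 wp psi_bij; have H0 := heis0 w psi_bij.
have dimH : (p ^ (2 * m))%N = (a.+1 ^ 2)%N by rewrite aE mulnC expnM.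
pose W v := kron phi (H v) 1%:M; pose iota := kron phi (1%:M : 'M[F]_a.+1).
have krM := kronM phi_bij.
have kr1 : kron phi 1%:M 1%:M = 1%:M :> 'M[F]_n.-1.+1 := kron1 F phi_bij.
have W0 : W 0 = 1%R by rewrite /W /H H0; exact: kr1.
have WM u v : (W u * W v = eps w (spform u v) *: W (u + v))%R.
  rewrite -[LHS]/(W u *m W v) /W krM mulmx1 -kronZl; congr kron; exact: HM.
have iotaM B C : (iota B * iota C = iota (B * C))%R.
  by rewrite -[LHS]/(iota B *m iota C) /iota krM mulmx1.
have W_iota v B : (W v * iota B = iota B * W v)%R.
  by rewrite -![(_ * _)%R]/(_ *m _) /W /iota !krM !mulmx1 !mul1mx.
have commutant_iota d : (forall v, W v * d = d * W v)%R -> exists B, d = iota B.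
  (* The Heisenberg-Weyl matrices span all matrices of size p^m, so commuting with the W_v means
     commuting with every A (x) 1. *)
  move=> dC; suff dA A : kron phi A 1%:M *m d = d *m kron phi A 1%:M.
    by have [B ->] := kron_commutant phi_bij dA; exists B.
  have [c ->] := Weyl_span p_pr p_odd m_gt0 wp w1 p_neq0 H0 HM dimH A.
  rewrite kron_suml mulmx_suml mulmx_sumr; apply: eq_bigr => v _.
  by rewrite kronZl -scalemxAl -scalemxAr; congr (_ *: _)%R; apply: dC.
have intertwiner (S : 'M['F_p]_((2 * m).-1.+1)) :
    (forall u v, spform (S *m u) (S *m v) = spform u v) ->
    exists2 P : 'M[F]_n.-1.+1, P \is a GRing.unit & forall v, (P * W v = W (S *m v) * P)%R.
  move=> Ssp.
  have [P PU PW] := Weyl_intertwiner p_pr p_odd m_gt0 wp w1 p_neq0 H0 HM dimH Ssp.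
  exists (kron phi P 1%:M).
    apply/unitrP; exists (kron phi (P^-1)%R 1%:M); rewrite -![(_ * _)%R]/(_ *m _) !krM !mulmx1.
    by rewrite -![(_ *m _)]/(_ * _)%R mulVr // mulrV // -[1%R]/(1%:M) kr1.
  move=> v; rewrite -![(_ * _)%R]/(_ *m _) /W !krM !mulmx1; congr kron; exact: PW.
have exW v : exists g : {'GL_n[F]}, GLval g = W v.
  exact: exists_GL (Weyl_unit p_pr m_gt0 W0 WM v).
have [gW gWE] := fin_all_exists exW.
have exI (B : {'GL_k[F]}) : exists g : {'GL_n[F]}, GLval g = iota (GLval B).
  have U : iota (GLval B) \is a GRing.unit.
    apply/unitrP; exists (iota (GLval B)^-1).
    by rewrite !iotaM mulVr ?mulrV ?GLval_unit //; split; apply: kr1.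
  exact: exists_GL U.
have [gI gIE] := fin_all_exists exI.
have iota_inj : injective iota := @kron1_inj F _ _ _ _ phi_bij.
have iotaZ c B : iota (c *: B)%R = (c *: iota B)%R by apply: kronZr.
have iota1 : iota 1%R = 1%R := kr1.
exists (Lam p_pr wp WM gWE); split; last first.
  exact: (norm_Lam_isog p_pr p_odd m_gt0 wp w1 W0 WM iota1 W_iota intertwiner gWE gIE).
split.
- by apply/subsetP => x _; apply: mem_PGL.
- exact: (Lam_abelem p_pr wp WM gWE).
- exact: (Lam_card p_pr p_odd m_gt0 wp w1 W0 WM iota1 W_iota gWE gIE).
- exact: (Lam_nontoral p_odd m_gt0 w1 W0).
exists k; last exact: (cent_Lam_isog p_pr p_odd m_gt0 wp w1 p_neq0 W0 WM iotaM iota1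
  iotaZ iota_inj W_iota commutant_iota gWE gIE).
rewrite k_gt0 nE ltn_Pmulr //.
by rewrite -{1}(exp1n m) ltn_exp2r // prime_gt1.
Qed.
End Existence.

Theorem theorem4p23 (p m : nat) (F : finFieldType) (n : nat)
    (K : closedFieldType) (f : {rmorphism F -> K}) :
  prime p -> odd p -> (0 < m)%N -> ~~ (p %| #|F|)%N -> (0 < n)%N ->
  algebraic_over f ->
  (forall L : {group PGLtype n F},
      L \subset PGL n F -> (p.-abelem L)%g -> #|L| = (p ^ (2 * m))%N ->
      ~ toral_in f L ->
      (exists2 k : nat, (0 < k < n)%N &
         ('C_(PGL n F)(L) \isog setX L (PGL k F))%g) ->
      ('N_(PGL n F)(L) / 'C_(PGL n F)(L) \isog Sp m p)%g ->
    (p ^ m %| n)%N /\ #|F| = 1 %[mod p])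
  /\
  ((p ^ m %| n)%N -> #|F| = 1 %[mod p] ->
    exists L : {group PGLtype n F},
      [/\ L \subset PGL n F, (p.-abelem L)%g, #|L| = (p ^ (2 * m))%N,
          ~ toral_in f L &
          (exists2 k : nat, (0 < k < n)%N &
             ('C_(PGL n F)(L) \isog setX L (PGL k F))%g)] /\
      ('N_(PGL n F)(L) / 'C_(PGL n F)(L) \isog Sp m p)%g).
Proof.
move=> p_pr p_odd m_gt0 pF n_gt0 _; split; last exact: (sufficiency f).
move=> L _ Lp oL ntoral _ isoSp.
exact: (necessity p_pr p_odd m_gt0 pF n_gt0 Lp oL ntoral isoSp).
Qed.
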